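(* Fix $\rho>0$ satisfying $H(\rho)+\rho<1$. There is a constant $C=C(\rho)>0$ such that for all $d\geq 2$, if $\mathcal{M}=\mathcal{M}(Q_d)$ is an ergodic $\rho$-local Markov chain on state space $\mathcal{C}_3(Q_d)$ with stationary distribution $\pi_3(Q_d)$, then $$\tau_{\mathcal{M}} \geq \exp_2\left\{\frac{C2^d}{\sqrt{d}\,\log d}\right\}.$$
   Context: $\log=\log_2$, $\exp_2 x=2^x$, and $H(x)=-x\log x-(1-x)\log(1-x)$ is the binary entropy function on $[0,1]$ (with $0\log 0=0$). $Q_d$ is the $d$-dimensional hypercube: the graph on vertex set $V=\{0,1\}^d$ in which two strings are adjacent iff they differ on exactly one coordinate. $\mathcal{C}_3(Q_d)$ is the set of proper $3$-colourings $\chi:V\to\{0,1,2\}$ of $Q_d$, and $\pi_3(Q_d)$ is the uniform probability distribution on it. A Markov chain $\mathcal{M}$ on $\mathcal{C}_3(Q_d)$ with transition probabilities $P_{\mathcal{M}}$ is $\rho$-local if $P_{\mathcal{M}}(\chi_1,\chi_2)\neq 0$ implies $|\{v\in V:\chi_1(v)\neq\chi_2(v)\}|\leq\rho|V|$. Ergodic means irreducible and aperiodic. The mixing time of a chain $\mathcal{M}$ on a finite state space $\Omega$ with transition probabilities $P$ and stationary distribution $\pi$ is $\tau_{\mathcal{M}}=\min\{t: d_{TV}(P^t,\pi)\leq 1/e\}$, where $P^t(x,y)$ is the $t$-step transition probability and $d_{TV}(P^t,\pi)=\max_{x\in\Omega}\frac12\sum_{y\in\Omega}|P^t(x,y)-\pi(y)|$.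 *)

(* Defs.v *)
From mathcomp Require Import all_boot all_order all_algebra.
From mathcomp Require Import all_classical all_reals all_analysis.

Set Implicit Arguments.
Unset Strict Implicit.
Unset Printing Implicit Defensive.

Import Order.TTheory GRing.Theory Num.Theory.
Local Open Scope ring_scope.

Definition log2 (R : realType) (x : R) : R := ln x / ln 2.

(* Meaningful on [0, 1]; [ln 0 = 0] gives the convention 0 log 0 = 0. *)
Definition entropy (R : realType) (x : R) : R :=
  - x * log2 x - (1 - x) * log2 (1 - x).

Section Hypercube.

Definition vertex (d : nat) := {ffun 'I_d -> bool}.

Definition adjacent (d : nat) : rel (vertex d) :=
  fun u v => #|[pred i | u i != v i]| == 1%N.

Definition proper_coloring (d : nat) (c : {ffun vertex d -> 'I_3}) : bool :=
  [forall u, forall v, adjacent u v ==> (c u != c v)].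

Definition coloring3 (d : nat) := {c : {ffun vertex d -> 'I_3} | proper_coloring c}.

Definition hamming (d : nat) (c1 c2 : coloring3 d) : nat :=
  #|[pred v | val c1 v != val c2 v]|.

End Hypercube.

Section MarkovChain.
Variables (R : realType) (T : finType).
Implicit Types (P : T -> T -> R) (pi : T -> R).

Definition uniform_dist : T -> R := fun=> #|T|%:R^-1.

Definition transition_kernel P : Prop :=
  (forall x y, 0 <= P x y) /\ (forall x, \sum_(y : T) P x y = 1).

Fixpoint kpow P (t : nat) : T -> T -> R :=
  if t is s.+1 then fun x y => \sum_(z : T) P x z * kpow P s z y
  else fun x y => (x == y)%:R.

Definition irreducible_chain P : Prop :=
  forall x y, exists t, 0 < kpow P t x y.

(* For every state the gcd of the set of its positive return times is 1. *)
Definition aperiodic_chain P : Prop :=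
  forall (x : T) (k : nat),
    (forall t : nat, (0 < t)%N -> 0 < kpow P t x x -> (k %| t)%N) -> k = 1%N.

Definition ergodic_chain P : Prop := irreducible_chain P /\ aperiodic_chain P.

Definition stationary_dist P pi : Prop :=
  forall y, \sum_(x : T) pi x * P x y = pi y.

(* The values are nonnegative, so the default 0 only matters if T is empty. *)
Definition dTV P pi : R :=
  \big[Num.max/0]_(x : T) (2^-1 * \sum_(y : T) `|P x y - pi y|).

(* The least t with dTV (P^t, pi) <= 1/e, and +oo if there is no such t (which
   does not happen for an ergodic chain with stationary distribution pi). *)
Definition mixing_time P pi : \bar R :=
  match pselect (exists t : nat, dTV (kpow P t) pi <= (expR 1)^-1) with
  | left ex_t => ((ex_minn ex_t)%:R)%:E
  | right _ => +oo%E
  end.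

End MarkovChain.

Arguments uniform_dist R T : clear implicits.

Definition local_chain (R : realType) (d : nat) (rho : R)
    (P : coloring3 d -> coloring3 d -> R) : Prop :=
  forall c1 c2, P c1 c2 != 0 -> (hamming c1 c2)%:R <= rho * #|vertex d|%:R.

(* Main.v *)
Require Import Defs.
From mathcomp Require Import all_boot all_order all_algebra.
From mathcomp Require Import all_classical all_reals all_analysis.
From mathcomp Require Import ring lra zify fintype finset.

(** Write [N = 2^d], [L = ln 2] and call a colouring balanced if the numbers of
    even and of odd vertices of colour 0 differ by at most [3/16 N].  Since
    [H(rho) + rho < 1] forces [rho <= 3/8], a [rho]-local chain cannot jump over
    the balanced colourings, so it suffices to show that there are at most
    [exp (N/2 L - c N / sqrt d)] of them, while there are at least [2^(N/2)]
    colourings in all.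

    Reveal a balanced colouring on a random set of [O(N ln d / d)] vertices, and
    reveal the few ([<= N / d^2]) vertices at which this sample misses a colour
    carried by a positive proportion of the neighbours.  Every other vertex
    either sees two colours in the sample, and its colour is then determined, or
    sees a single one, which is then carried by almost all its neighbours.
    Shearer's inequality bounds the logarithm of the number of colourings
    compatible with what was revealed by [N/2 (L + L/d)].  The loss in this bound
    is at least a constant times the size of a set of vertices whose removal
    leaves only edges between vertices of the same type, the type recording
    which parity class is locally determined, and in which colour.  By an
    isoperimetric inequality such a set has at least [c N / sqrt d] elements
    unless one type occupies nearly all the cube; in that case a direct entropy
    estimate applies, because the colouring is balanced. *)

Set Implicit Arguments.
Unset Strict Implicit.
Unset Printing Implicit Defensive.

Import Order.TTheory GRing.Theory Num.Theory.
Local Open Scope ring_scope.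

(** * Isoperimetry in the cube *)

Section Cube.
Variable d : nat.
Implicit Types (u v : vertex d) (i j : 'I_d).

Definition flip i v : vertex d := [ffun j => (j == i) (+) v j].

Lemma flipK i : involutive (flip i).
Proof. by move=> v; apply/ffunP => j; rewrite !ffunE addKb. Qed.

Lemma flip_inj i : injective (flip i).
Proof. exact: inv_inj (flipK i). Qed.

Lemma flipC i j v : flip i (flip j v) = flip j (flip i v).
Proof. by apply/ffunP => k; rewrite !ffunE addbCA. Qed.

Lemma flip_eq i j v : (flip i v == flip j v) = (i == j).
Proof.
apply/eqP/eqP => [/ffunP /(_ i)|->//].
by rewrite !ffunE eqxx => /addIb /esym/eqP.
Qed.

Lemma adjacentP u v : reflect (exists i, v = flip i u) (Defs.adjacent u v).
Proof.
apply: (iffP idP) => [/card1P [i Hi]|[i ->]].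
  exists i; apply/ffunP => j; rewrite ffunE.
  by have := Hi j; rewrite !inE => <-; case: (u j); case: (v j).
apply/card1P; exists i => j; rewrite !inE ffunE.
by case: (j == i); case: (u j).
Qed.

Definition parity v : bool := \big[addb/false]_i v i.

Lemma parity_flip i v : parity (flip i v) = ~~ parity v.
Proof.
rewrite /parity; under eq_bigr do rewrite ffunE.
rewrite big_split /= (bigD1 i) //= eqxx big1 => [|j /negPf->//].
by rewrite addbF.
Qed.

Lemma sum_flip (W : nmodType) (F : vertex d -> W) i :
  \sum_v F (flip i v) = \sum_v F v.
Proof. by rewrite [RHS](reindex_inj (@flip_inj i)). Qed.

Lemma card_vertex : #|{: vertex d}| = (2 ^ d)%N.
Proof. by rewrite card_ffun card_bool card_ord. Qed.

End Cube.

(** * Functional isoperimetric inequality, by averaging out one coordinate at a time *)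

Section Isoperimetry.
Variables (R : realType) (d : nat).
Implicit Types (f : vertex d -> R) (v : vertex d) (i k : 'I_d) (s : seq 'I_d).

Definition hypot (a b : R) : R := Num.sqrt (a ^+ 2 + b ^+ 2).

Lemma hypot_ge0 a b : 0 <= hypot a b.
Proof. exact: sqrtr_ge0. Qed.

Lemma hypot_sqr a b : hypot a b ^+ 2 = a ^+ 2 + b ^+ 2.
Proof. by rewrite sqr_sqrtr // addr_ge0 // sqr_ge0. Qed.

Lemma le_hypot a b a' b' : 0 <= a <= a' -> 0 <= b <= b' -> hypot a b <= hypot a' b'.
Proof.
move=> /andP[a0 aa] /andP[b0 bb]; apply: ler_wsqrtr; apply: lerD;
  by rewrite lerXn2r // nnegrE ?(le_trans _ aa) ?(le_trans _ bb).
Qed.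

Lemma hypotD a b a' b' : hypot (a + a') (b + b') <= hypot a b + hypot a' b'.
Proof.
have h0 := hypot_ge0; have hs := hypot_sqr.
rewrite -ler_sqr ?nnegrE ?addr_ge0 ?h0 // sqrrD !hs.
have : a * a' + b * b' <= hypot a b * hypot a' b'.
  case: (lerP (a * a' + b * b') 0) => [le0|gt0]; first by rewrite (le_trans le0) ?mulr_ge0.
  rewrite -ler_sqr ?nnegrE ?mulr_ge0 ?(ltW gt0) // exprMn !hs.
  have := sqr_ge0 (a * b' - b * a'); nra.
nra.
Qed.

Lemma hypotZ2 a b : hypot (2 * a) (2 * b) = 2 * hypot a b.
Proof.
rewrite /hypot !exprMn -mulrDr sqrtrM ?exprn_ge0 //.
by rewrite sqrtr_sqr ger0_norm.
Qed.

Definition posdiff f i v : R := Num.max 0 (f v - f (flip i v)).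

(** Variance of a Bernoulli variable of mean [x]; it plays the role of the isoperimetric profile. *)
Definition jvar (x : R) : R := x * (1 - x).

(** Euclidean norm of the vector formed by [a] and the one-sided differences along [s] (see
    [gradnorm_sqr]). The accumulator form lets the induction on [s] absorb one coordinate into
    [a]. *)
Definition gradnorm f v s (a : R) : R := foldl (fun b i => hypot (posdiff f i v) b) a s.

Definition avgc k f v : R := (f v + f (flip k v)) / 2.

Lemma posdiff_ge0 f i v : 0 <= posdiff f i v.
Proof. by rewrite /posdiff le_max lexx. Qed.

Lemma posdiff_avgc f i k v :
  2 * posdiff (avgc k f) i v <= posdiff f i v + posdiff f i (flip k v).
Proof.
rewrite /posdiff /avgc (flipC k i).
set a := f v; set b := f (flip i v); set a' := f (flip k v); set b' := f _.
rewrite maxr_pMr // mulr0 ge_max; apply/andP; split.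
  by rewrite addr_ge0 // le_max lexx.
have h1 : a - b <= Num.max 0 (a - b) by rewrite le_max lexx orbT.
have h2 : a' - b' <= Num.max 0 (a' - b') by rewrite le_max lexx orbT.
lra.
Qed.

(** Convexity of the norm: [hypot] is monotone and subadditive, and the one-sided differences of an
    average are at most the averages of the differences. *)
Lemma gradnorm_avgc f k v s a a' b : 0 <= b -> 2 * b <= a + a' ->
  2 * gradnorm (avgc k f) v s b <= gradnorm f v s a + gradnorm f (flip k v) s a'.
Proof.
elim: s a a' b => [//|i s IH] a a' b b0 hb /=; apply: IH; first exact: hypot_ge0.
rewrite -hypotZ2; apply: le_trans (hypotD _ _ _ _); apply: le_hypot.
  by rewrite posdiff_avgc mulr_ge0 // posdiff_ge0.
by rewrite hb mulr_ge0.
Qed.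

(* A two-point inequality in the style of Bobkov, with one-sided gradients; it
   drives the induction on the coordinates. *)
Lemma jvar_two_points p q : 0 <= p <= 1 -> 0 <= q <= 1 ->
  2 * jvar ((p + q) / 2) <= hypot (Num.max 0 (p - q)) (jvar p)
                          + hypot (Num.max 0 (q - p)) (jvar q).
Proof.
wlog: p q / q <= p => [H|qp] hp hq.
  case: (leP q p) => [/H|/ltW/H H1]; first exact.
  by rewrite (addrC p q) [X in _ <= X]addrC; apply: H1.
have -> : Num.max 0 (q - p) = 0 by apply/max_idPl; rewrite subr_le0.
have -> : Num.max 0 (p - q) = p - q by apply/max_idPr; rewrite subr_ge0.
have Jq : 0 <= jvar q by rewrite /jvar; nra.
have -> : hypot 0 (jvar q) = jvar q.
  by rewrite /hypot expr0n add0r sqrtr_sqr ger0_norm.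
rewrite -lerBlDr.
have -> : 2 * jvar ((p + q) / 2) - jvar q = jvar p + (p - q) ^+ 2 / 2.
  by rewrite /jvar; field.
have Jp : 0 <= jvar p by rewrite /jvar; nra.
(* With [e = (p - q) ^+ 2], squaring leaves [e * jvar p + e ^+ 2 / 4 <= e], which follows from
   [jvar p <= 1 / 4] and [e <= 1]. *)
rewrite -ler_sqr ?nnegrE ?hypot_ge0 ?addr_ge0 ?divr_ge0 ?sqr_ge0 // hypot_sqr.
have Jp4 : jvar p <= 1 / 4 by rewrite /jvar; have := sqr_ge0 (p - 1/2); nra.
have e1 : (p - q) ^+ 2 <= 1 by nra.
have e0 := sqr_ge0 (p - q).
move: e0 e1; set e := (p - q) ^+ 2; nra.
Qed.

(** The induction hypothesis is applied to the average along [k]. Pairing each [v] with [flip k v],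
    the two-point inequality bounds the new [jvar] term and [gradnorm_avgc] carries this bound
    through the remaining coordinates. *)
Lemma sum_gradnorm s f : (forall v, 0 <= f v <= 1) ->
  \sum_v jvar (foldl (fun g k => avgc k g) f s v)
    <= \sum_v gradnorm f v s (jvar (f v)).
Proof.
elim: s f => [//|k s IH] f hf /=.
have hA v : 0 <= avgc k f v <= 1.
  by have := hf v; have := hf (flip k v); rewrite /avgc; lra.
apply: le_trans (IH _ hA) _.
rewrite -(ler_pM2l (ltr0Sn R 1)) !mulr_sumr.
have -> : \sum_v 2 * gradnorm f v s (hypot (posdiff f k v) (jvar (f v))) =
  \sum_v (gradnorm f v s (hypot (posdiff f k v) (jvar (f v))) +
   gradnorm f (flip k v) s (hypot (posdiff f k (flip k v)) (jvar (f (flip k v))))).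
  rewrite big_split /= (sum_flip (fun v => gradnorm f v s (hypot (posdiff f k v) (jvar (f v))))).
  by rewrite -mulr_sumr mulrDl mul1r.
apply: ler_sum => v _; apply: gradnorm_avgc.
  by rewrite /jvar; have := hA v; nra.
rewrite {2}/posdiff flipK; exact: jvar_two_points.
Qed.

Lemma foldl_avgc_sum s f : \sum_v foldl (fun g k => avgc k g) f s v = \sum_v f v.
Proof.
elim: s f => [//|k s IH] f /=; rewrite IH -mulr_suml big_split /= sum_flip.
by field.
Qed.

(** Averaging along [i] creates invariance under [flip i], and later averagings preserve it; the
    disjunction is what makes the induction go through. *)
Lemma foldl_avgc_flip s f i v :
  (i \in s) || [forall u, f (flip i u) == f u] ->
  foldl (fun g k => avgc k g) f s (flip i v) = foldl (fun g k => avgc k g) f s v.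
Proof.
elim: s f => [|k s IH] f /=; first by move=> /forallP/(_ v)/eqP.
rewrite inE => H; apply: IH; case/orP: H => [/orP[/eqP->|->//]|/forallP H].
  by apply/orP; right; apply/forallP => u; rewrite /avgc flipK addrC.
apply/orP; right; apply/forallP => u.
by rewrite /avgc flipC (eqP (H u)) (eqP (H (flip k u))).
Qed.

Lemma flip_invariant_const (T : Type) (g : vertex d -> T) :
  (forall i v, g (flip i v) = g v) -> forall u v, g u = g v.
Proof.
move=> H u v; move En : #|[pred i | u i != v i]| => n.
elim: n u En => [|n IH] u En.
  congr g; apply/ffunP => i; apply/eqP; rewrite -[_ == _]negbK.
  by have := card0_eq En i; rewrite !inE => ->.
have [i Hi] : exists i, i \in [pred i | u i != v i].
  by apply/card_gt0P; rewrite En.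
rewrite -(H i u); apply: IH; apply/eqP; rewrite -eqSS -En (cardD1 i [pred i | u i != v i]) Hi.
rewrite eqSS; apply/eqP/eq_card => j; rewrite !inE ffunE.
case: (eqVneq j i) => [->|//]; rewrite inE in Hi.
by move: Hi; case: (u i); case: (v i).
Qed.

Lemma gradnorm_sqr f v s a :
  gradnorm f v s a ^+ 2 = a ^+ 2 + \sum_(i <- s) posdiff f i v ^+ 2.
Proof.
elim: s a => [|i s IH] a; first by rewrite big_nil addr0.
by rewrite /= IH hypot_sqr big_cons addrA [_ + a ^+ 2]addrC.
Qed.

Lemma gradnorm_ge0 f v s a : 0 <= a -> 0 <= gradnorm f v s a.
Proof. by elim: s a => [//|i s IH] a a0 /=; apply/IH/hypot_ge0. Qed.

Definition outer_boundary (A : {set vertex d}) : {set vertex d} :=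
  [set v | (v \notin A) && [exists i, flip i v \in A]].

(** The functional inequality is applied to the indicator of the complement of [A]. Its full average
    is the constant [1 - #|A| / 2 ^+ d], and its one-sided gradient vanishes except on the outer
    boundary, where the norm is at most [sqrt d]. *)
Theorem isoperimetry (A : {set vertex d}) :
  #|A|%:R * (2 ^+ d - #|A|%:R) <= (2 ^+ d) * Num.sqrt d%:R * #|outer_boundary A|%:R :> R.
Proof.
pose f v : R := (v \notin A)%:R.
have hf v : 0 <= f v <= 1 by rewrite /f; case: (_ \notin _); rewrite /= ?lexx ?ler01.
have := sum_gradnorm (enum 'I_d) hf.
set g := foldl _ f _.
have gc : forall u v, g u = g v.
  by apply: flip_invariant_const => i v; apply: foldl_avgc_flip; rewrite mem_enum.
have N0 : (2 ^+ d : R) != 0 by rewrite expf_neq0.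
have gE v : g v = 1 - #|A|%:R / 2 ^+ d.
  have : \sum_u g u = \sum_u f u := foldl_avgc_sum _ _.
  have -> : \sum_u f u = 2 ^+ d - #|A|%:R.
    rewrite -[2]/(2%:R) -natrX -card_vertex -sum1_card natr_sum -sum1_card natr_sum.
    rewrite [X in _ = _ - X]big_mkcond -sumrB; apply: eq_bigr => u _.
    by rewrite /f; case: (u \in A); rewrite /= ?subr0 ?subrr.
  under eq_bigr do rewrite (gc _ v).
  rewrite sumr_const card_vertex -(mulr_natl _ (2 ^ d)) natrX => H.
  by apply: (mulfI N0); rewrite H; field.
under eq_bigr do rewrite gE.
rewrite sumr_const card_vertex -(mulr_natl _ (2 ^ d)) natrX /jvar => H.
suff: \sum_v gradnorm f v (enum 'I_d) (jvar (f v)) <= Num.sqrt d%:R * #|outer_boundary A|%:R.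
  move=> /(le_trans H); rewrite -(ler_pM2l (_ : 0 < 2 ^+ d)) ?exprn_gt0 //.
  rewrite -mulrA; apply: le_trans.
  by rewrite le_eqVlt; apply/orP; left; apply/eqP; field.
rewrite -(sum1_card (mem (outer_boundary A))) natr_sum mulr_sumr [X in _ <= X]big_mkcond /=.
apply: ler_sum => v _.
have -> : jvar (f v) = 0 by rewrite /jvar /f; case: (_ \notin _); rewrite ?subrr ?mulr0 ?mul0r.
have pd i : posdiff f i v = ((v \notin A) && (flip i v \in A))%:R.
  rewrite /posdiff /f; case: (v \in A); case: (_ \in A); rewrite /= ?subrr ?subr0 ?maxxx //.
  - by apply/max_idPl; rewrite sub0r oppr_le0.
  - by apply/max_idPr.
rewrite -ler_sqr ?nnegrE ?gradnorm_ge0 //; last by case: ifP => _ //; rewrite mulr1 sqrtr_ge0.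
rewrite gradnorm_sqr expr0n add0r; under eq_bigr do rewrite pd.
case: ifPn => [_|].
  rewrite mulr1 sqr_sqrtr // big_enum /=.
  apply: le_trans (_ : \sum_(i < d) 1 <= _); last by rewrite sumr_const card_ord.
  by apply: ler_sum => i _; case: (_ && _); rewrite ?expr1n ?expr0n.
rewrite inE negb_and negb_exists expr0n /= => H0; rewrite big1 // => i _.
case/orP: H0 => [/negPf->|/forallP/(_ i)/negPf->]; by rewrite ?andbF expr0n.
Qed.

End Isoperimetry.

(** * Entropy of a uniform random function *)

Lemma ln_le_subr1 (R : realType) (x : R) : 0 < x -> ln x <= x - 1.
Proof. by move=> x0; have := @le_ln1Dx R (x - 1); rewrite addrCA subrr addr0; apply; lra. Qed.

Section Entropy.
Variables (R : realType) (I C : finType) (S : {set {ffun I -> C}}).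
Hypothesis S_gt0 : (0 < #|S|)%N.
Implicit Types (x y z : {ffun I -> C}) (A B D : {set I}) (F G : {ffun I -> C} -> R).

Definition agree A : rel {ffun I -> C} := fun x y => [forall v in A, x v == y v].

Lemma agreeP A x y : reflect {in A, x =1 y} (agree A x y).
Proof. exact: (iffP eqfun_inP). Qed.

Lemma agree_refl A : reflexive (agree A).
Proof. by move=> x; apply/agreeP. Qed.

Lemma agree_sym A : symmetric (agree A).
Proof. by move=> x y; apply/agreeP/agreeP => H v vA; rewrite H. Qed.

Lemma agree_trans A : transitive (agree A).
Proof. by move=> y x z /agreeP xy /agreeP yz; apply/agreeP => v vA; rewrite xy ?yz. Qed.

Lemma agree_eq A x y : agree A x y -> agree A x =1 agree A y.
Proof.
move=> xy z; apply/idP/idP; last exact: agree_trans.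
by apply: agree_trans; rewrite agree_sym.
Qed.

Lemma agree_sub A B x y : A \subset B -> agree B x y -> agree A x y.
Proof. by move=> /subsetP AB /agreeP xy; apply/agreeP => v /AB /xy. Qed.

Lemma agreeU A B x y : agree (A :|: B) x y = agree A x y && agree B x y.
Proof.
apply/idP/andP => [H|[/agreeP hA /agreeP hB]].
  by split; apply: agree_sub H; rewrite ?subsetUl ?subsetUr.
by apply/agreeP => v; rewrite inE => /orP[/hA|/hB].
Qed.

Lemma agree1 v x y : agree [set v] x y = (x v == y v).
Proof.
apply/agreeP/eqP => [->//|xy w]; first by rewrite inE.
by rewrite inE => /eqP->.
Qed.

(** For a uniform element of [S], the restriction to [A] takes the value it has at [x] with
    probability [fibsize A x / #|S|]; entropies thus become averages of logarithms of fibre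
    sizes. *)
Definition fiber A x : {set {ffun I -> C}} := [set y in S | agree A x y].
Definition fibsize A x : R := #|fiber A x|%:R.

Lemma fibsize_gt0 A x : x \in S -> 0 < fibsize A x.
Proof. by move=> xS; rewrite ltr0n; apply/card_gt0P; exists x; rewrite inE xS agree_refl. Qed.

Lemma fibsize_eq A x y : agree A x y -> fibsize A x = fibsize A y.
Proof.
by move=> xy; congr _%:R; apply: eq_card => z; rewrite !inE (agree_eq xy).
Qed.

Lemma le_fibsize A B x : A \subset B -> fibsize B x <= fibsize A x.
Proof.
move=> AB; rewrite ler_nat; apply/subset_leq_card/subsetP => y.
by rewrite !inE => /andP[->]; exact: agree_sub.
Qed.

(** All of [Q] lies in one fibre, and every term is the inverse of the size of that fibre. *)
Lemma sum_inv_fibsize_le1 A (Q : pred {ffun I -> C}) :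
  (forall x, Q x -> x \in S) -> (forall x y, Q x -> Q y -> agree A x y) ->
  \sum_(x | Q x) (fibsize A x)^-1 <= 1.
Proof.
move=> QS Qagree; case: (pickP Q) => [x0 Qx0|Q0]; last by rewrite big_pred0.
rewrite (eq_bigr (fun=> (fibsize A x0)^-1)) => [|x Qx]; last first.
  by rewrite (fibsize_eq (Qagree _ _ Qx Qx0)).
rewrite sumr_const -[_ *+ _]mulr_natl ler_pdivrMr ?fibsize_gt0 ?QS // mul1r ler_nat.
by apply/subset_leq_card/subsetP => x Qx; rewrite inE (QS _ Qx) Qagree.
Qed.

Lemma sum_fibsize A G : \sum_(x in S) fibsize A x * G x
  = \sum_(x in S) \sum_(y in S | agree A x y) G y.
Proof.
rewrite (exchange_big_dep (mem S)) /=; last by move=> x y _ /andP[].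
apply: eq_bigr => y yS.
rewrite sumr_const -mulr_natl; congr (_%:R * _); apply: eq_card => x.
by rewrite !inE yS agree_sym.
Qed.

Definition avg F : R := (\sum_(x in S) F x) / #|S|%:R.

Lemma cardS_gt0 : 0 < #|S|%:R :> R. Proof. by rewrite ltr0n. Qed.
Lemma cardS_neq0 : #|S|%:R != 0 :> R. Proof. by rewrite lt0r_neq0 ?cardS_gt0. Qed.
Hint Resolve cardS_gt0 cardS_neq0 : core.

Lemma avgD F G : avg (fun x => F x + G x) = avg F + avg G.
Proof. by rewrite /avg big_split mulrDl. Qed.

Lemma avgB F G : avg (fun x => F x - G x) = avg F - avg G.
Proof. by rewrite /avg sumrB mulrBl. Qed.

Lemma avgZ k F : avg (fun x => k * F x) = k * avg F.
Proof. by rewrite /avg -mulr_sumr mulrA. Qed.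

Lemma avg_cst k : avg (fun=> k) = k.
Proof. by rewrite /avg sumr_const -(mulr_natr k) mulfK. Qed.

Lemma avg_sum (J : Type) (r : seq J) (P : pred J) (F : J -> {ffun I -> C} -> R) :
  avg (fun x => \sum_(j <- r | P j) F j x) = \sum_(j <- r | P j) avg (F j).
Proof. by rewrite /avg exchange_big mulr_suml. Qed.

Lemma le_avg F G : (forall x, x \in S -> F x <= G x) -> avg F <= avg G.
Proof. by move=> FG; rewrite ler_wpM2r ?invr_ge0 //; exact: ler_sum. Qed.

Lemma eq_avg F G : (forall x, x \in S -> F x = G x) -> avg F = avg G.
Proof. by move=> FG; congr (_ / _); exact: eq_bigr. Qed.

(* Entropies are in nats. *)
Definition ent A : R := avg (fun x => ln (#|S|%:R / fibsize A x)).

Definition cent (B A : {set I}) : R := ent (A :|: B) - ent A.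

(** Jensen's inequality in the form obtained from [ln x <= x - 1]. The inequalities [cent_anti],
    [ent_gibbs] and [cent_le_ln_card] reduce to it, their two sides differing by the average of a
    single logarithm. *)
Lemma avg_ln_le0 F : (forall x, x \in S -> 0 < F x) ->
  \sum_(x in S) F x <= #|S|%:R -> avg (fun x => ln (F x)) <= 0.
Proof.
move=> F0 sF; apply: le_trans (le_avg (G := fun x => F x - 1) _) _ => [x xS|].
  exact/ln_le_subr1/F0.
by rewrite avgB avg_cst subr_le0 ler_pdivrMr // mul1r.
Qed.

Lemma centE B A : cent B A = avg (fun x => ln (fibsize A x / fibsize (A :|: B) x)).
Proof.
rewrite /cent /ent -avgB; apply: eq_avg => x xS.
have [a b] := (fibsize_gt0 A xS, fibsize_gt0 (A :|: B) xS).
rewrite !ln_div ?posrE //; ring.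
Qed.

(** Submodularity: conditioning on more vertices lowers the entropy. *)
Lemma cent_anti A B D : A \subset B -> cent D B <= cent D A.
Proof.
move=> AB; rewrite -subr_le0 !centE -avgB.
have pos := fibsize_gt0.
rewrite (eq_avg (G := fun x => ln (fibsize B x *
    (fibsize (A :|: D) x / fibsize (B :|: D) x / fibsize A x)))); last first.
  by move=> x xS; rewrite ?lnM ?lnV ?posrE ?mulr_gt0 ?invr_gt0 ?pos //; ring.
apply: avg_ln_le0 => [x xS|]; first by rewrite !mulr_gt0 ?invr_gt0 ?pos.
rewrite sum_fibsize -sum1_card natr_sum; apply: ler_sum => x xS.
rewrite (eq_bigr (fun y => fibsize (A :|: D) y / fibsize (B :|: D) y / fibsize A x)).
  2: by move=> y /andP[_ xy]; rewrite (fibsize_eq (agree_sub AB xy)).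
rewrite -mulr_suml ler_pdivrMr ?pos // mul1r.
rewrite (eq_bigr (fun y =>
    \sum_(z in fiber A x | agree (A :|: D) y z) (fibsize (B :|: D) y)^-1)); last first.
  move=> y /andP[_ xy]; rewrite sumr_const -mulr_natl; congr (_%:R * _).
  apply: eq_card => z; rewrite [RHS]unfold_in !inE; case: (z \in S) => //=.
  by rewrite agreeU (agree_eq (agree_sub AB xy)); case: (agree A y z).
(* For fixed [z], the remaining [y] agree with [x] on [B] and with [z] on [A :|: D], hence with each
   other on [B :|: D]; their inverse fibre sizes sum to at most 1. *)
rewrite (exchange_big_dep (mem (fiber A x))) /=; last by move=> y z _ /andP[].
rewrite /fibsize -[in X in _ <= X]sum1_card natr_sum; apply: ler_sum => z _.
apply: sum_inv_fibsize_le1 => [y /andP[/andP[]]//|y y'].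
move=> /and3P[/andP[_ h1] _]; rewrite agreeU => /andP[_ h2].
move=> /and3P[/andP[_ h3] _]; rewrite agreeU => /andP[_ h4].
by rewrite agreeU (agree_eq h2) -(agree_eq h1) h3 agree_sym.
Qed.

Lemma ent0 : ent set0 = 0.
Proof.
rewrite /ent (eq_avg (G := fun=> 0)) ?avg_cst // => x _.
rewrite (_ : fibsize _ _ = #|S|%:R) ?divff ?ln1 //.
congr _%:R; apply: eq_card => y; rewrite inE andb_idr // => _.
by apply/agreeP => v; rewrite inE.
Qed.

Lemma entT : ent setT = ln #|S|%:R.
Proof.
rewrite /ent (eq_avg (G := fun=> ln #|S|%:R)) ?avg_cst // => x xS.
rewrite (_ : fibsize _ _ = 1) ?divr1 // /fibsize (_ : fiber _ _ = [set x]) ?cards1 //.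
apply/setP => y; rewrite !inE; apply/andP/eqP => [[_ /agreeP xy]|->].
  by apply/ffunP => v; rewrite xy ?inE.
by rewrite agree_refl.
Qed.

Lemma ent_mono A B : A \subset B -> ent A <= ent B.
Proof.
move=> AB; apply: le_avg => x xS.
have [a b] := (fibsize_gt0 A xS, fibsize_gt0 B xS).
rewrite ler_ln ?posrE ?divr_gt0 // ler_pM2l // lef_pV2 ?posrE //.
exact: le_fibsize.
Qed.

Lemma ent_ge0 A : 0 <= ent A.
Proof. by rewrite -ent0 ent_mono ?sub0set. Qed.

Lemma cent_le B A : cent B A <= ent B.
Proof.
apply: le_trans (cent_anti _ (sub0set A)) _.
by rewrite /cent ent0 subr0 set0U.
Qed.

Lemma ent_cst v : (forall x y, x \in S -> y \in S -> x v = y v) -> ent [set v] = 0.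
Proof.
move=> H; rewrite /ent (eq_avg (G := fun=> 0)) ?avg_cst // => x xS.
rewrite (_ : fibsize _ _ = #|S|%:R) ?divff ?ln1 //.
congr _%:R; apply: eq_card => y; rewrite inE andb_idr // => yS.
by rewrite agree1 (H _ _ xS yS).
Qed.

(** Gibbs' inequality: coding by any subprobability [W] on data that determine [A] costs at least
    the entropy. The numerical entropy bounds below come from explicit choices of [W]. *)
Lemma ent_gibbs A (T : finType) (X : {ffun I -> C} -> T) (W : T -> R) :
  (forall x y, x \in S -> y \in S -> X x = X y -> agree A x y) ->
  (forall t, 0 <= W t) -> \sum_t W t <= 1 -> (forall x, x \in S -> 0 < W (X x)) ->
  ent A <= avg (fun x => - ln (W (X x))).
Proof.
move=> XA W0 W1 Wpos; rewrite -subr_le0 -avgB.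
have pos := fibsize_gt0.
rewrite (eq_avg (G := fun x => ln (#|S|%:R * (W (X x) / fibsize A x)))); last first.
  by move=> x xS; rewrite ?lnM ?lnV ?posrE ?mulr_gt0 ?invr_gt0 ?pos ?Wpos //; ring.
apply: avg_ln_le0 => [x xS|]; first by rewrite !mulr_gt0 ?invr_gt0 ?pos ?Wpos.
rewrite -mulr_sumr -[leRHS]mulr1 ler_pM2l //; apply: le_trans W1.
rewrite (partition_big X predT) //=; apply: ler_sum => t _.
rewrite (eq_bigr (fun x => W t * (fibsize A x)^-1)) => [|x /andP[_ /eqP->]//].
rewrite -mulr_sumr -[leRHS]mulr1 ler_wpM2l //.
apply: sum_inv_fibsize_le1 => [x /andP[]//|x y /andP[xS /eqP Xx] /andP[yS /eqP Xy]].
by apply: XA => //; rewrite Xx Xy.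
Qed.

Lemma cent_le_ln_card v A (k : {ffun I -> C} -> nat) :
  (forall x, x \in S -> (#|[set (y : {ffun I -> C}) v | y in fiber A x]| <= k x)%N) ->
  cent [set v] A <= avg (fun x => ln (k x)%:R).
Proof.
move=> hk; pose m x := #|[set (y : {ffun I -> C}) v | y in fiber A x]|.
have m0 x : x \in S -> (0 < m x)%N.
  by move=> xS; apply/card_gt0P; exists (x v); apply: imset_f; rewrite inE xS agree_refl.
have mR x : x \in S -> 0 < (m x)%:R :> R by move=> xS; rewrite ltr0n m0.
apply: le_trans (_ : avg (fun x => ln (m x)%:R) <= _); last first.
  apply: le_avg => x xS; rewrite ler_ln ?posrE ?mR //; first by rewrite ler_nat hk.
  by rewrite ltr0n (leq_trans (m0 _ xS)) // hk.
have pos := fibsize_gt0.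
rewrite -subr_le0 centE -avgB.
rewrite (eq_avg (G := fun x =>
    ln (fibsize A x * ((m x)%:R^-1 / fibsize (A :|: [set v]) x)))); last first.
  by move=> x xS; rewrite ?lnM ?lnV ?posrE ?mulr_gt0 ?invr_gt0 ?invr_gt0 ?mR ?pos //; ring.
apply: avg_ln_le0 => [x xS|]; first by rewrite !mulr_gt0 ?invr_gt0 ?pos ?mR.
rewrite sum_fibsize -sum1_card natr_sum; apply: ler_sum => x xS.
rewrite (eq_bigr (fun y => (m x)%:R^-1 * (fibsize (A :|: [set v]) y)^-1)); last first.
  move=> y /andP[_ xy]; congr (_%:R^-1 * _); congr #|pred_of_set (imset _ (mem (pred_of_set _)))|.
  by apply/setP => z; rewrite !inE (agree_eq xy).
rewrite -mulr_sumr mulrC ler_pdivrMr ?mR // mul1r.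
rewrite (partition_big (fun y : {ffun I -> C} => y v)
    (mem [set (y : {ffun I -> C}) v | y in fiber A x])) /=; last first.
  by move=> y /andP[yS xy]; apply: imset_f; rewrite inE yS.
rewrite /m -[in leRHS]sum1_card natr_sum; apply: ler_sum => c _.
apply: sum_inv_fibsize_le1 => [y /andP[/andP[]]//|y z].
move=> /andP[/andP[yS xy] /eqP yc] /andP[/andP[zS xz] /eqP zc].
by rewrite agreeU agree1 yc zc eqxx -(agree_eq xy) xz.
Qed.

Lemma ent_subadd (s : seq I) : ent [set v in s] <= \sum_(v <- s) ent [set v].
Proof.
elim: s => [|v s IH].
  by rewrite big_nil (_ : [set v in [::]] = set0) ?ent0 //; apply/setP => v; rewrite !inE.
rewrite big_cons set_cons setUC.
have := cent_le [set v] [set w in s]; rewrite /cent; lra.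
Qed.

(** Vertices are revealed one by one. The increment at [v] is counted by at least [k] of the sets
    [N j], and within such a set it only grows, since less has been revealed there. *)
Lemma ent_shearer (J : finType) (N : J -> {set I}) (E : {set I}) (k : nat) :
  (forall v, v \in E -> (k <= #|[set j | v \in N j]|)%N) ->
  k%:R * ent E <= \sum_j ent (N j).
Proof.
move=> hk.
suff H (s : seq I) : {subset s <= E} -> k%:R * ent [set v in s] <= \sum_j ent (N j :&: [set v in s]).
  have := H (enum E); rewrite (_ : [set v in enum E] = E); last first.
    by apply/setP => v; rewrite inE mem_enum.
  have sub : {subset enum E <= E} by move=> v; rewrite mem_enum.
  move=> /(_ sub) H'; apply: le_trans H' _.
  by apply: ler_sum => j _; rewrite ent_mono ?subsetIl.
elim: s => [|v s IH] sE.
  rewrite (_ : [set v in [::]] = set0); last by apply/setP => v; rewrite !inE.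
  by rewrite ent0 mulr0; apply: sumr_ge0 => j _; exact: ent_ge0.
have {}IH := IH (fun w ws => sE w (mem_behead (s := v :: s) ws)).
have vE : v \in E by rewrite sE // mem_head.
rewrite set_cons setUC; set A := [set w in s] in IH *.
have d0 : 0 <= cent [set v] A by rewrite subr_ge0 ent_mono ?subsetUl.
rewrite (_ : ent (A :|: _) = ent A + cent [set v] A); last by rewrite /cent addrC subrK.
rewrite mulrDr; apply: le_trans (lerD IH (_ : _ <= \sum_(j | v \in N j) cent [set v] A)) _.
  rewrite sumr_const -(mulr_natl (cent _ _)) ler_wpM2r // ler_nat; apply: leq_trans (hk _ vE) _.
  by apply/subset_leq_card/subsetP => j; rewrite inE.
rewrite [X in _ + X]big_mkcond -big_split /=; apply: ler_sum => j _.
case: ifPn => vN; last by rewrite addr0 ent_mono // setIS // subsetUl.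
rewrite setIUr (_ : N j :&: [set v] = [set v]); last first.
  by apply/setIidPr; rewrite sub1set.
rewrite -lerBrDl; apply: cent_anti; exact: subsetIr.
Qed.

(** Chain rule, with the conditioning at each [v] weakened from everything revealed so far to
    [N v]. *)
Lemma ent_chain (E : {set I}) (N : I -> {set I}) (s : seq I) :
  (forall v, v \in s -> N v \subset E) ->
  ent (E :|: [set v in s]) <= ent E + \sum_(v <- s) cent [set v] (N v).
Proof.
elim: s => [|v s IH] hN.
  by rewrite big_nil addr0 (_ : [set v in [::]] = set0) ?setU0 //; apply/setP => v; rewrite !inE.
have {}IH := IH (fun w ws => hN w (mem_behead (s := v :: s) ws)).
rewrite big_cons set_cons [_ |: _]setUC setUA.
have := @cent_anti (N v) (E :|: [set w in s]) [set v]
  (subset_trans (hN _ (mem_head _ _)) (subsetUl _ _)).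
rewrite {1}/cent; lra.
Qed.

End Entropy.

(** * Local structure of a class of colourings *)

Section Log2.
Variable R : realType.

Lemma ln2_ge : 1 / 2 <= ln 2 :> R.
Proof.
have := @ln_le_subr1 R 2^-1; rewrite invr_gt0 ltr0n => /(_ isT).
rewrite lnV ?posrE //; lra.
Qed.

Lemma ln2_gt0 : 0 < ln 2 :> R.
Proof. by have := ln2_ge; lra. Qed.

Lemma ln2_le : ln 2 <= 3 / 4 :> R.
Proof.
have : ln 2 <= ln ((9 / 8) ^+ 6) :> R by rewrite ler_ln ?posrE ?exprn_gt0 //; lra.
rewrite lnXn; last lra.
have : ln (9 / 8) <= 9 / 8 - 1 :> R by apply: ln_le_subr1; lra.
lra.
Qed.

Lemma ln3_le : ln 3 <= 8 / 5 * ln 2 :> R.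
Proof.
have : ln (3 ^+ 5) <= ln (2 ^+ 8) :> R by rewrite ler_ln ?posrE ?exprn_gt0 //; lra.
by rewrite !lnXn //; lra.
Qed.

End Log2.

Lemma sum_ord3 (W : comRingType) (a b : 'I_3) (x y z : W) : a != b ->
  \sum_(t < 3) (if t == a then x else if t == b then y else z) = x + y + z.
Proof.
rewrite 3!big_ord_recl big_ord0 addr0.
by case: a b => [[|[|[|//]]] ?] [[|[|[|//]]] ?]; rewrite -?val_eqE //= => _; ring.
Qed.

Lemma ord3_third (a b x y : 'I_3) : a != b -> x != a -> x != b -> y != a -> y != b -> x = y.
Proof.
rewrite -!val_eqE => h1 h2 h3 h4 h5; apply/eqP; rewrite -val_eqE; move: h1 h2 h3 h4 h5 => /=.
by case: a b x y => [[|[|[|//]]] ?] [[|[|[|//]]] ?] [[|[|[|//]]] ?] [[|[|[|//]]] ?].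
Qed.

Lemma sum_cst_in (W : pzRingType) (T : finType) (P : pred T) (x : W) :
  \sum_(i in P) x = #|P|%:R * x.
Proof. by rewrite sumr_const mulr_natl. Qed.

Lemma sum_cst_ord (W : pzRingType) n (x : W) : \sum_(i < n) x = n%:R * x.
Proof. by rewrite sumr_const card_ord mulr_natl. Qed.

(** Union bound; it selects a direction in which the neighbours avoid several exceptional sets at
    once. *)
Lemma exists_not_covered d (s : seq {set 'I_d}) :
  (sumn [seq #|A| | A : {set 'I_d} <- s] < d)%N -> exists i, all (fun A : {set 'I_d} => i \notin A) s.
Proof.
move=> lt; apply/existsP; apply: contraLR lt; rewrite negb_exists -leqNgt => /forallP H.
have sub : [set: 'I_d] \subset \bigcup_(A <- s) A.
  apply/subsetP => i _; have /allPn [A As] := H i; rewrite negbK => iA.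
  by rewrite (big_rem A) //= inE iA.
apply: leq_trans (_ : #|\bigcup_(A <- s) A| <= _)%N.
  by rewrite -[X in (X <= _)%N](card_ord d) -cardsT subset_leq_card.
elim: s {H sub} => [|A s IH]; first by rewrite big_nil cards0.
by rewrite big_cons /= (leq_trans (leq_card_setU _ _)) // leq_add2l.
Qed.

(** * Local entropy bounds and the loss in Shearer's inequality *)

Section LocalStructure.
Variables (R : realType) (d : nat) (S : {set {ffun vertex d -> 'I_3}}).
(* Vertices of [K] have the known colour [lab v] throughout [S]; at a vertex of
   [U] nothing is known but that nearly all neighbours have colour [lab v]. *)
Variables (U K : {set vertex d}) (lab : vertex d -> 'I_3).
Hypothesis d_gt0 : (0 < d)%N.
Hypothesis S_gt0 : (0 < #|S|)%N.
Hypothesis S_proper : forall x v i, x \in S -> x (flip i v) != x v.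
Hypothesis U_lab : forall x v, v \in U -> x \in S -> x v != lab v.
Hypothesis U_nbr : forall x v, v \in U -> x \in S ->
  (#|[set i | x (flip i v) != lab v]| * 128 <= d)%N.
Hypothesis K_lab : forall x v, v \in K -> x \in S -> x v = lab v.

Implicit Types (x : {ffun vertex d -> 'I_3}) (v : vertex d) (i j : 'I_d).

Let L : R := ln 2.
Let L_ge : 1 / 2 <= L. Proof. exact: ln2_ge. Qed.
Let L_gt0 : 0 < L. Proof. exact: ln2_gt0. Qed.
Let dR_gt0 : 0 < d%:R :> R. Proof. by rewrite ltr0n. Qed.
Let dR_neq0 : d%:R != 0 :> R. Proof. by rewrite lt0r_neq0. Qed.
Hint Resolve dR_gt0 dR_neq0 : core.

Local Notation avg := (avg S).
Local Notation ent := (@ent R _ _ S).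
Local Notation cent := (@cent R _ _ S).

Definition vent v : R := ent [set v].
Definition prne v c : R := avg (fun x => (x v != c)%:R).
Definition nbr v : {set vertex d} := [set flip i v | i : 'I_d].
(* Shearer's inequality gives [ln #|S| <= \sum_(v odd) cost v], where each term is
   at most [L + L / d] up to the contribution of the vertices outside [U :|: K];
   [slack v] is what the term of [v] loses. *)
Definition cost v : R := ent (nbr v) / d%:R + cent [set v] (nbr v).
Definition slack v : R := L + L / d%:R - cost v.
Definition mono v x : bool := [forall i, x (flip i v) == lab v].
Definition prnm v : R := avg (fun x => (~~ mono v x)%:R).

Lemma vent_gibbs v (W : 'I_3 -> R) : (forall t, 0 <= W t) -> \sum_t W t <= 1 ->
  (forall x, x \in S -> 0 < W (x v)) -> vent v <= avg (fun x => - ln (W (x v))).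
Proof.
move=> W0 W1 Wpos; apply: (ent_gibbs S_gt0 (X := fun x => x v)) => // x y _ _ /eqP.
by rewrite agree1.
Qed.

Lemma vent_le_ln3 v : vent v <= ln 3.
Proof.
apply: le_trans (vent_gibbs (W := fun=> 3^-1) _ _ _) _ => //.
- by rewrite sum_cst_ord divff.
- by rewrite avg_cst // lnV ?posrE // opprK.
Qed.

Lemma vent_le_ln2 v c : (forall x, x \in S -> x v != c) -> vent v <= L.
Proof.
move=> H; have [c' cc'] : exists c' : 'I_3, c != c'.
  by exists (if c == ord0 then ord_max else ord0); case: (eqVneq c ord0) => [->|].
apply: le_trans (vent_gibbs (W := fun t => if t == c then 0 else if t == c' then 1/2 else 1/2) _ _ _) _.
- by move=> t; do 2 case: ifP => _ //.
- by rewrite sum_ord3 //; lra.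
- by move=> x /H /negPf->; case: ifP => _; lra.
rewrite (eq_avg (G := fun=> L)) ?avg_cst // => x /H /negPf->.
by rewrite if_same div1r lnV ?posrE // opprK.
Qed.

(** Weight 15/16 on [c] and 1/32 on each other colour costs at most [1 / 15] at [c] and [5 * L]
    elsewhere, and [1 / 15 + 5 * L / 16 <= L / 2] because [L >= 1 / 2]. *)
Lemma vent_skew v c : prne v c <= 1 / 16 -> vent v <= L / 2.
Proof.
move=> H; have [c' cc'] : exists c' : 'I_3, c != c'.
  by exists (if c == ord0 then ord_max else ord0); case: (eqVneq c ord0) => [->|].
apply: le_trans (vent_gibbs (W := fun t =>
  if t == c then 15/16 else if t == c' then 1/32 else 1/32) _ _ _) _.
- by move=> t; do 2 case: ifP => _ //.
- by rewrite sum_ord3 //; lra.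
- by move=> x _; do ?case: ifP => _; lra.
apply: le_trans (_ : avg (fun x => 1 / 15 + 5 * L * (x v != c)%:R) <= _).
  apply: le_avg => // x _; case: ifP => _ /=.
    rewrite mulr0 addr0; have <- : ln (16 / 15) = - ln (15 / 16) :> R.
      by rewrite -(invf_div 15 16) lnV ?posrE //; lra.
    by have := @ln_le_subr1 R (16 / 15); lra.
  rewrite if_same div1r lnV ?posrE // opprK mulr1.
  have -> : 32 = 2 ^+ 5 :> R by lra.
  by rewrite lnXn // -/L; lra.
have := ler_wpM2l (ltW L_gt0) H; rewrite avgD avg_cst // avgZ -/(prne v c); have := L_ge; lra.
Qed.

Lemma ent_nbr_le v : ent (nbr v) <= \sum_i vent (flip i v).
Proof.
have := ent_subadd R S_gt0 [seq flip i v | i <- enum 'I_d].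
rewrite big_map big_enum /=; apply: le_trans; rewrite le_eqVlt; apply/orP; left; apply/eqP.
congr ent; apply/setP => w; rewrite inE.
by apply/imsetP/mapP => -[i ? ->]; exists i; rewrite ?mem_enum.
Qed.

(** Crude bound, meant for the few vertices outside [U :|: K]. *)
Lemma cost_le v : cost v <= 4.
Proof.
have h3 := ln3_le R; have h2 := ln2_le R; rewrite -/L in h3 h2.
have := vent_le_ln3 v; have := cent_le R S_gt0 [set v] (nbr v); rewrite -/(vent v) /cost => h4 h5.
suff: ent (nbr v) / d%:R <= ln 3 by lra.
rewrite ler_pdivrMr // (le_trans (ent_nbr_le v)) //.
apply: le_trans (ler_sum _ (G := fun=> ln 3) _) _; first by move=> i _; exact: vent_le_ln3.
by rewrite sum_cst_ord mulrC.
Qed.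

Lemma vent_K v : v \in K -> vent v = 0.
Proof. by move=> vK; apply: (ent_cst R S_gt0) => x y xS yS; rewrite !K_lab. Qed.

Lemma vent_nbr_K v i : v \in K -> vent (flip i v) <= L.
Proof.
by move=> vK; apply: (@vent_le_ln2 _ (lab v)) => x xS; rewrite -(K_lab vK xS) S_proper.
Qed.

(** A vertex of [K] has no entropy of its own, so its cost is at most the mean entropy of its
    neighbours; each of these avoids the colour [lab v] and has entropy at most [L]. *)
Lemma slack_K v : v \in K -> (\sum_i (L - vent (flip i v))) / d%:R <= slack v.
Proof.
move=> vK; have := cent_le R S_gt0 [set v] (nbr v); rewrite -/(vent v) vent_K // /slack /cost => h.
have := ent_nbr_le v; rewrite -(ler_pM2r (_ : 0 < d%:R^-1)) ?invr_gt0 // => h'.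
rewrite sumrB mulrBl sum_cst_ord mulrAC divff // mul1r.
have : 0 <= L / d%:R by rewrite divr_ge0 // ltW.
lra.
Qed.

Lemma slack_K_ge0 v : v \in K -> 0 <= slack v.
Proof.
move=> vK; apply: le_trans (slack_K vK); rewrite divr_ge0 // sumr_ge0 // => i _.
by rewrite subr_ge0 vent_nbr_K.
Qed.

(** The code is an even mixture of the constant colouring [lab v] and a product of skewed weights. A
    monochromatic neighbourhood costs at most [L]; any other one costs at most
    [L + d / 15 + 5 * L * d / 128], the number of exceptions being at most [d / 128]. *)
Lemma ent_nbr_U v : v \in U -> ent (nbr v) <= L + prnm v * (d%:R * L / 4).
Proof.
move=> vU; set l := lab v.
have [l' ll'] : exists l' : 'I_3, l != l'.
  by exists (if l == ord0 then ord_max else ord0); case: (eqVneq l ord0) => [->|].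
pose om (t : 'I_3) : R := if t == l then 15/16 else if t == l' then 1/32 else 1/32.
have om_sum : \sum_t om t = 1 by rewrite sum_ord3 //; lra.
have om_gt0 t : 0 < om t by rewrite /om; do ?case: ifP => _; lra.
pose X x : {ffun 'I_d -> 'I_3} := [ffun i => x (flip i v)].
pose W (t : {ffun 'I_d -> 'I_3}) : R := 1/2 * (t == [ffun=> l])%:R + 1/2 * \prod_i om (t i).
have Wgt0 t : 0 < W t.
  by rewrite ltr_wpDl ?mulr_ge0 // mulr_gt0 // prodr_gt0.
apply: le_trans (ent_gibbs S_gt0 (X := X) (W := W) _ _ _ _) _ => //.
- move=> x y _ _ /ffunP Xxy; apply/agreeP => w /imsetP [i _ ->].
  by have := Xxy i; rewrite !ffunE.
- by move=> t; exact/ltW.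
- rewrite big_split /= -!mulr_sumr.
  have -> : \sum_t \prod_i om ((t : {ffun 'I_d -> 'I_3}) i) = 1.
    by rewrite -(bigA_distr_bigA (fun _ t => om t)) /= big1.
  rewrite (bigD1 [ffun=> l]) //= eqxx big1 => [|t /negPf->//]; rewrite /=; lra.
rewrite /prnm mulrC -avgZ -[X in X + _](@avg_cst R _ _ S S_gt0) -avgD.
apply: le_avg => // x xS.
have XE : (X x == [ffun=> l]) = mono v x.
  apply/eqP/forallP => [/ffunP H i|H]; first by have := H i; rewrite !ffunE => ->.
  by apply/ffunP => i; rewrite !ffunE; exact/eqP.
case: (boolP (mono v x)) => m /=.
  rewrite mulr0 addr0 -lnV ?posrE // ler_ln ?posrE ?invr_gt0 //.
  rewrite -[leRHS]invrK lef_pV2 ?posrE ?invr_gt0 // /W XE m mulr1 div1r lerDl.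
  by rewrite mulr_ge0 ?prodr_ge0 // => i _; exact/ltW.
rewrite mulr1 /W XE (negPf m) mulr0 add0r lnM ?posrE ?prodr_gt0 //.
rewrite div1r lnV ?posrE // -/L opprD opprK lerD2l.
pose e (t : 'I_3) : R := 1 / 15 + 5 * L * (t != l)%:R.
have om_ge t : expR (- e t) <= om t.
  rewrite expRN -[leRHS]invrK lef_pV2 ?posrE ?invr_gt0 ?expR_gt0 // /om /e.
  case: eqP => _ /=.
    by rewrite mulr0 addr0; apply: le_trans (expR_ge1Dx _); lra.
  rewrite if_same mulr1 div1r invrK.
  have -> : 32 = expR (5 * L) by rewrite mulrC expRM_natr lnK ?posrE //; lra.
  by rewrite ler_expR; lra.
apply: le_trans (_ : \sum_i e (X x i) <= _).
  rewrite -(expRK (\sum_i _)) -lnV ?posrE ?prodr_gt0 // ler_ln ?posrE ?expR_gt0 ?invr_gt0 ?prodr_gt0 //.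
  rewrite -[leRHS]invrK lef_pV2 ?posrE ?invr_gt0 ?expR_gt0 ?prodr_gt0 // -expRN -sumrN expR_sum.
  by apply: ler_prod => i _; rewrite expR_ge0 om_ge.
rewrite /e big_split /= sum_cst_ord -mulr_sumr.
have -> : \sum_i ((X x i != l)%:R : R) = #|[set i | x (flip i v) != lab v]|%:R.
  rewrite -sum1_card natr_sum [RHS]big_mkcond /=; apply: eq_bigr => i _.
  by rewrite inE /X ffunE; case: eqP.
have := U_nbr vU xS; rewrite -(ler_nat R) natrM => h.
have h1 := ler_wpM2l (ltW L_gt0) h; have h2 := ler_wpM2l (ltW dR_gt0) L_ge.
have h3 : 0 <= d%:R * L by rewrite mulr_ge0 ?ltW.
lra.
Qed.

Lemma prnm_ge0 v : 0 <= prnm v.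
Proof. by rewrite -(@avg_cst R _ _ S S_gt0 0); apply: le_avg. Qed.

Lemma prnm_le1 v : prnm v <= 1.
Proof. by rewrite -(@avg_cst R _ _ S S_gt0 1); apply: le_avg => // x _; case: (~~ _). Qed.

(** A neighbourhood entirely of colour [lab v] leaves two choices at [v]. Any other one shows a
    second colour, and since [v] avoids [lab v] as well, its colour is determined. *)
Lemma cent_U v : v \in U -> cent [set v] (nbr v) <= (1 - prnm v) * L.
Proof.
move=> vU; have -> : (1 - prnm v) * L = avg (fun x => ln (if mono v x then 2 else 1)%:R).
  rewrite -[X in X - _](@avg_cst R _ _ S S_gt0 1) -avgB mulrC -avgZ; apply: eq_avg => x _.
  by case: (mono v x); rewrite /= ?ln1 -/L; lra.
apply: (@cent_le_ln_card R _ _ S S_gt0 v (nbr v) (fun x => if mono v x then 2 else 1)%N) => x xS.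
case: ifPn => m.
  apply: leq_trans (_ : #|[set~ lab v]| <= 2)%N; last by rewrite cardsC1 card_ord.
  apply/subset_leq_card/subsetP => c /imsetP [y]; rewrite !inE => /andP[yS _] ->.
  exact: U_lab.
have [i hi] : exists i, x (flip i v) != lab v by apply/existsP; rewrite -negb_forall.
have [j hj] : exists j, x (flip j v) == lab v.
  apply/existsP; apply: contraLR (U_nbr vU xS); rewrite negb_exists -ltnNge => /forallP H.
  rewrite (_ : [set i | _] = setT) ?cardsT ?card_ord; first by rewrite ltn_Pmulr.
  by apply/setP => k; rewrite !inE H.
apply: leq_trans (_ : #|~: [set x (flip i v); lab v]| <= 1)%N; last first.
  by rewrite cardsCs setCK card_ord cards2 hi.
apply/subset_leq_card/subsetP => c /imsetP [y]; rewrite !inE => /andP[yS /agreeP xy] ->.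
rewrite negb_or (U_lab vU yS) andbT xy; first by rewrite eq_sym S_proper.
by apply/imsetP; exists i.
Qed.

Lemma slack_U v : v \in U -> 3 / 4 * L * prnm v <= slack v.
Proof.
move=> vU; have h1 := cent_U vU; have h2 := ent_nbr_U vU.
rewrite -(ler_pM2r (_ : 0 < d%:R^-1)) ?invr_gt0 // in h2.
have e : (L + prnm v * (d%:R * L / 4)) / d%:R = L / d%:R + prnm v * L / 4 by field.
rewrite /slack /cost; lra.
Qed.

(** Here the conditional entropy of [v] is bounded by [vent v] instead of [cent_U]. *)
Lemma slack_U_vent v : v \in U -> vent v <= L / 2 -> L / 4 <= slack v.
Proof.
move=> vU hv; have h1 := cent_le R S_gt0 [set v] (nbr v); have h2 := ent_nbr_U vU.
rewrite -(ler_pM2r (_ : 0 < d%:R^-1)) ?invr_gt0 // in h2.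
have e : (L + prnm v * (d%:R * L / 4)) / d%:R = L / d%:R + prnm v * L / 4 by field.
have := ler_wpM2l (ltW L_gt0) (prnm_le1 v); rewrite -/(vent v) in h1; rewrite /slack /cost; lra.
Qed.

Lemma slack_ge0 v : v \in U :|: K -> 0 <= slack v.
Proof.
rewrite inE => /orP[vU|/slack_K_ge0//]; apply: le_trans (slack_U vU).
by rewrite mulr_ge0 ?prnm_ge0 // mulr_ge0 ?(ltW L_gt0).
Qed.

(** Shearer's inequality bounds the even vertices by the neighbourhoods of the odd ones, which cover
    each even vertex [d] times; each odd vertex is then revealed given its neighbourhood. *)
Lemma ln_card_le : ln #|S|%:R <= \sum_(v | parity v) cost v.
Proof.
rewrite -(entT R S_gt0); set E := [set v : vertex d | ~~ parity v].
have -> : [set: vertex d] = E :|: [set v in enum [pred v : vertex d | parity v]].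
  by apply/setP => v; rewrite !inE mem_enum inE orNb.
have nE v : parity v -> nbr v \subset E.
  by move=> pv; apply/subsetP => w /imsetP [i _ ->]; rewrite inE parity_flip pv.
apply: le_trans (ent_chain R S_gt0 (N := nbr) _) _ => // [v|].
  by rewrite mem_enum; exact: nE.
rewrite big_enum /cost.
have -> : \sum_(v : vertex d | parity v) (ent (nbr v) / d%:R + cent [set v] (nbr v)) =
  \sum_(v | parity v) ent (nbr v) / d%:R + \sum_(v | parity v) cent [set v] (nbr v).
  exact: big_split.
apply: lerD => //; rewrite -mulr_suml ler_pdivlMr // mulrC.
apply: le_trans (ent_shearer R S_gt0 (k := d)
  (N := fun v => if parity v then nbr v else set0) _) _ => //.
  move=> v; rewrite inE => pv.
  rewrite -[X in (X <= _)%N](card_ord d) -(card_imset _ (f := fun i => flip i v)); last first.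
    by move=> i j /eqP; rewrite flip_eq => /eqP.
  apply/subset_leq_card/subsetP => w /imsetP [i _ ->]; rewrite inE parity_flip pv.
  by apply/imsetP; exists i; rewrite ?flipK.
rewrite [leRHS]big_mkcond; apply: ler_sum => v _; case: ifP => // _.
by rewrite ent0.
Qed.

(** * Exceptional vertices and their number *)

Definition bad : {set vertex d} := ~: (U :|: K).

Lemma card_parity b : (#|[pred v : vertex d | parity v == b]| * 2 = 2 ^ d)%N.
Proof.
rewrite muln2 -addnn -card_vertex -[RHS](cardC [pred v : vertex d | parity v == b]).
congr addn; rewrite -(card_image (@flip_inj _ (Ordinal d_gt0))).
apply: eq_card => v; rewrite !inE; apply/imageP/idP => [[w]|pv].
  by rewrite inE => /eqP <- ->; rewrite parity_flip; case: parity.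
exists (flip (Ordinal d_gt0) v); rewrite ?flipK // inE parity_flip.
by move: pv; case: parity; case: b.
Qed.

Lemma card_parityR b : #|[pred v : vertex d | parity v == b]|%:R = 2 ^+ d / 2 :> R.
Proof.
by apply: (mulIf (_ : 2 != 0)) => //; rewrite divfK // -natrM card_parity natrX.
Qed.

(** Upper bound for the total slack, after 4 is allowed for each bad vertex as in [cost_le]. *)
Definition deficit : R := 2 ^+ d / 2 * (L + L / d%:R) + 4 * #|bad|%:R - ln #|S|%:R.

Lemma sum_slack_le : \sum_(v | parity v && (v \in U :|: K)) slack v <= deficit.
Proof.
rewrite /deficit -(card_parityR true) lerBrDr.
apply: le_trans (lerD (lexx _) ln_card_le) _.
rewrite [X in _ + X](bigID (mem (U :|: K))) /= addrA -big_split /=.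
under eq_bigr do rewrite /slack subrK.
apply: lerD; last first.
  apply: le_trans (_ : \sum_(v in bad) 4 <= _); last by rewrite sum_cst_in mulrC.
  rewrite [leLHS]big_mkcond [leRHS]big_mkcond; apply: ler_sum => v _.
  by rewrite !inE; case: (parity v) => /=; case: ifP => // _; exact: cost_le.
have LL : 0 <= L + L / d%:R by rewrite addr_ge0 ?divr_ge0 ?ltW.
rewrite sum_cst_in ler_wpM2r // ler_nat.
by apply/subset_leq_card/subsetP => v; rewrite !inE => /andP[->].
Qed.

Definition heavyY : {set vertex d} :=
  [set v | [&& parity v, v \in U :|: K & L / 32 <= slack v]].

Definition nbrs_in (A : {set vertex d}) v : {set 'I_d} := [set i | flip i v \in A].

Lemma in_nbrs_in (A : {set vertex d}) v i : (i \in nbrs_in A v) = (flip i v \in A).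
Proof. by rewrite in_set. Qed.

(** Even vertices that contribute a constant amount in total to the slack of their neighbours in
    [K], through [slack_K]; the letters [X] and [Y] stand for the even and the odd class. *)
Definition heavyX : {set vertex d} :=
  [set v | ~~ parity v & d%:R * L / 8 <= #|nbrs_in K v|%:R * (L - vent v)].

Lemma card_heavyY : #|heavyY|%:R * L <= 32 * deficit.
Proof.
have := sum_slack_le; rewrite (bigID (mem heavyY)) /= => h.
have : \sum_(v in heavyY) (L / 32) <= deficit.
  apply: le_trans h; rewrite -[leLHS]addr0; apply: lerD; last first.
    by rewrite sumr_ge0 // => v /andP[/andP[_ /slack_ge0]].
  rewrite [leRHS](eq_bigl (mem heavyY)); last first.
    by move=> v; rewrite !inE; case: (parity v) => //=; case: (_ || _).
  by apply: ler_sum => v; rewrite inE => /and3P[].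
rewrite sum_cst_in; lra.
Qed.

Lemma sum_nbrs_in (A : {set vertex d}) (P : pred (vertex d)) (F : vertex d -> R) :
  \sum_(v | P v) #|nbrs_in A v|%:R * F v = \sum_(v in A) \sum_(i | P (flip i v)) F (flip i v).
Proof.
transitivity (\sum_(v | P v) \sum_(i | flip i v \in A) F v).
  apply: eq_bigr => v _; rewrite sum_cst_in; congr (_%:R * _).
  by apply: eq_card => i; rewrite inE.
rewrite (exchange_big_dep predT) //= [RHS](exchange_big_dep predT) //=; apply: eq_bigr => i _.
rewrite [LHS](reindex_inj (@flip_inj _ i)) /=; apply: eq_bigl => v.
by rewrite flipK andbC.
Qed.

(** Double counting of the edges between even vertices and odd vertices of [K], with weight
    [L - vent] at the even end. *)
Lemma card_heavyX : #|heavyX|%:R * L <= 8 * deficit.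
Proof.
suff : \sum_(v | ~~ parity v) #|nbrs_in K v|%:R * (L - vent v) <= d%:R * deficit.
  move=> h; rewrite -(ler_pM2l dR_gt0).
  have : \sum_(v in heavyX) (d%:R * L / 8) <= d%:R * deficit.
    apply: le_trans h; rewrite [leLHS]big_mkcond [leRHS]big_mkcond; apply: ler_sum => v _.
    rewrite inE; case: (boolP (~~ parity v)) => //= _; case: ifPn => // _.
    case: (set_0Vmem (nbrs_in K v)) => [->|[i]]; first by rewrite cards0 mul0r.
    rewrite inE => iK; rewrite mulr_ge0 // subr_ge0.
    by have := vent_nbr_K i iK; rewrite flipK.
  rewrite sum_cst_in; lra.
rewrite sum_nbrs_in mulrC -ler_pdivrMr // mulr_suml.
apply: le_trans sum_slack_le; rewrite [leLHS]big_mkcond [leRHS]big_mkcond /=.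
apply: ler_sum => v _; rewrite [in leRHS]inE; case: ifPn => [vK|_]; last first.
  by case: ifP => // /andP[_]; rewrite orbF => vU; apply: slack_ge0; rewrite inE vU.
rewrite orbT andbT; case: ifPn => pv; last first.
  by rewrite big_pred0 ?mul0r // => i; rewrite parity_flip negbK (negPf pv).
apply: le_trans (slack_K vK); rewrite le_eqVlt; apply/orP; left; apply/eqP.
by congr (_ / _); apply: eq_bigl => i; rewrite parity_flip pv.
Qed.

Definition dense (A : {set vertex d}) : {set vertex d} :=
  [set v | (d <= 16 * #|nbrs_in A v|)%N].

Lemma card_dense A : (#|dense A| <= 16 * #|A|)%N.
Proof.
rewrite -(leq_pmul2r d_gt0) -(ler_nat R) !natrM.
have -> : 16 * #|A|%:R * d%:R = 16 * \sum_(v : vertex d) (#|nbrs_in A v|%:R * 1) :> R.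
  rewrite sum_nbrs_in (eq_bigr (fun=> d%:R)); last by move=> v _; rewrite sum_cst_ord mulr1.
  by rewrite sum_cst_in mulrA.
rewrite -sum_cst_in mulr_sumr [leLHS]big_mkcond /=; apply: ler_sum => v _.
by rewrite inE; case: ifP; rewrite ?mulr_ge0 // mulr1 -natrM ler_nat.
Qed.

(** Two rounds of closure: [no_KK] looks from [v] to neighbours outside [cover2], and [vent_U_even]
    looks from there to neighbours outside [cover1]. Each round multiplies the size by at most
    17. *)
Definition cover1 := bad :|: heavyX :|: heavyY.
Definition cover2 := cover1 :|: dense cover1.
Definition tcover := cover2 :|: dense cover2.

Lemma card_tcover : (#|tcover| <= 289 * #|cover1|)%N.
Proof.
have h2 : (#|cover2| <= 17 * #|cover1|)%N.
  apply: leq_trans (leq_card_setU _ _) _; have := card_dense cover1; lia.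
apply: leq_trans (leq_card_setU _ _) _; have := card_dense cover2; lia.
Qed.

Lemma card_tcover_le : #|tcover|%:R * L <= 289 * (#|bad|%:R * L + 40 * deficit).
Proof.
have := card_heavyX; have := card_heavyY; have := card_tcover.
have := (leq_card_setU (bad :|: heavyX) heavyY).1; have := (leq_card_setU bad heavyX).1.
rewrite -/cover1 -!(ler_nat R) !natrM !natrD => h1 h2 h3 h4 h5.
have L0 := ltW L_gt0.
have := ler_wpM2r L0 h1; have := ler_wpM2r L0 h2; have := ler_wpM2r L0 h3; lra.
Qed.

Lemma nbrs_in_small A v : v \notin dense A -> (16 * #|nbrs_in A v| < d)%N.
Proof. by rewrite inE -ltnNge. Qed.

Lemma nbrs_in_sub (A B : {set vertex d}) v : A \subset B -> (#|nbrs_in A v| <= #|nbrs_in B v|)%N.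
Proof.
by move=> /subsetP AB; apply/subset_leq_card/subsetP => i; rewrite !inE => /AB.
Qed.

Lemma bad_cover1 : bad \subset cover1.
Proof. by rewrite /cover1 -setUA subsetUl. Qed.

Lemma heavyY_cover1 : heavyY \subset cover1.
Proof. exact: subsetUr. Qed.

Lemma notin_cover1 v : v \notin cover1 -> [/\ v \in U :|: K, v \notin heavyX & v \notin heavyY].
Proof.
by rewrite /cover1 2!in_setU !negb_or /bad in_setC negbK => /andP[/andP[-> ->] ->].
Qed.

Lemma notin_cover2 v : v \notin cover2 -> v \notin cover1 /\ v \notin dense cover1.
Proof. by rewrite inE negb_or => /andP. Qed.

Lemma prne_sum_U v (A : {set 'I_d}) : v \in U ->
  128 * \sum_(i in A) prne (flip i v) (lab v) <= d%:R.
Proof.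
move=> vU; rewrite -avg_sum // -avgZ -(@avg_cst R _ _ S S_gt0 d%:R).
apply: le_avg => // x xS; have := U_nbr vU xS; rewrite -(ler_nat R) natrM mulrC.
apply: le_trans; rewrite ler_wpM2l // -sum1_card natr_sum [leLHS]big_mkcond [leRHS]big_mkcond /=.
by apply: ler_sum => i _; rewrite inE; do 2 case: ifP.
Qed.

(** Suppose [v] had small entropy. It would then have few neighbours in [K], not being in [heavyX],
    and few exceptional ones. Some neighbour in [U] would have colour [lab v] with probability at
    least 15/16, hence small entropy, hence large slack by [slack_U_vent], although it is not in
    [heavyY]. *)
Lemma vent_U_even v : ~~ parity v -> v \in U -> v \notin cover2 -> L / 2 < vent v.
Proof.
move=> pv vU /notin_cover2 [v1 vd]; rewrite ltNge; apply/negP => hv.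
have [_ vX _] := notin_cover1 v1.
have hK : (4 * #|nbrs_in K v| < d)%N.
  move: vX; rewrite inE pv /= -ltNge -(ltr_nat R) natrM => h.
  have := ler_wpM2l (ler0n R #|nbrs_in K v|) hv.
  rewrite -(ltr_pM2r L_gt0); lra.
have h1 := nbrs_in_small vd.
have hb := nbrs_in_sub v bad_cover1; have hY := nbrs_in_sub v heavyY_cover1.
pose A := [set i | (flip i v \in U) && (1 / 16 < prne (flip i v) (lab v))].
have hA : (8 * #|A| <= d)%N.
  rewrite -(ler_nat R) natrM; apply: le_trans (prne_sum_U A vU).
  have : \sum_(i in A) (1 / 16) <= \sum_(i in A) prne (flip i v) (lab v).
    by apply: ler_sum => i; rewrite inE => /andP[_ /ltW].
  rewrite sum_cst_in; lra.
have [|i] := @exists_not_covered _ [:: nbrs_in K v; nbrs_in bad v; nbrs_in heavyY v; A].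
  have arith (k c b y a n : nat) : (4 * k < n -> 16 * c < n -> b <= c -> y <= c ->
    8 * a <= n -> k + (b + (y + (a + 0))) < n)%N by clear; lia.
  exact: arith hK h1 hb hY hA.
rewrite /= andbT => /and4P[iK ib iY iA].
move: iK ib; rewrite !inE negbK => /negPf ->; rewrite orbF => iU.
move: iA; rewrite inE iU /= -leNgt => /vent_skew /(slack_U_vent iU) hs.
move: iY; rewrite inE inE parity_flip pv inE iU /= -ltNge; have := L_gt0; lra.
Qed.

Lemma prnm_ge v i c : c = lab v -> prne (flip i v) c <= prnm v.
Proof.
move=> ->; apply: le_avg => // x _; rewrite ler_nat; case: (boolP (mono v x)) => //=.
  by move=> /forallP /(_ i) ->.
by move=> _; case: (_ != _).
Qed.

(** By [vent_U_even] and [vent_skew], [v] avoids the label of [flip i v] with probability above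
    1/16. Were [flip i v] in [U], its neighbourhood would fail to be monochromatic that often,
    making it heavy by [slack_U]. *)
Lemma no_UU v i : ~~ parity v -> v \in U -> v \notin cover2 -> flip i v \notin heavyY ->
  flip i v \notin U.
Proof.
move=> pv vU v2 hY; apply: contra hY => iU.
rewrite inE parity_flip pv inE iU /=; apply: le_trans (slack_U iU).
have := vent_U_even pv vU v2; rewrite ltNge => /negP h.
have h' : 1 / 16 < prne v (lab (flip i v)).
  by rewrite ltNge; apply/negP => /vent_skew.
have := @prnm_ge (flip i v) i _ erefl; rewrite flipK; have := L_gt0; nra.
Qed.

(** With different labels, [v] would avoid two colours and so be constant on [S], against
    [vent_U_even]. *)
Lemma same_lab_UK v i : ~~ parity v -> v \in U -> v \notin cover2 -> flip i v \in K ->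
  lab v = lab (flip i v).
Proof.
move=> pv vU v2 iK; apply: contraTeq (vent_U_even pv vU v2) => ne.
rewrite -leNgt (_ : vent v = 0); first by rewrite divr_ge0 // ltW.
apply: (ent_cst R S_gt0) => x y xS yS.
apply: (ord3_third ne); rewrite ?U_lab //.
  by rewrite -(K_lab iK xS) -[X in x X != _](flipK i) S_proper.
by rewrite -(K_lab iK yS) -[X in y X != _](flipK i) S_proper.
Qed.

(** With different labels, the neighbourhood of [flip i v] would never be monochromatic in its
    label, so [slack_U] would make that vertex heavy. *)
Lemma same_lab_KU v i : ~~ parity v -> v \in K -> flip i v \in U -> flip i v \notin heavyY ->
  lab v = lab (flip i v).
Proof.
move=> pv vK iU iY; apply: contraNeq iY => ne.
rewrite inE parity_flip pv inE iU /=; apply: le_trans (slack_U iU).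
have := @prnm_ge (flip i v) i _ erefl; rewrite flipK.
rewrite /prne (eq_avg (G := fun=> 1)); last by move=> x xS; rewrite (K_lab vK xS) ne.
by rewrite avg_cst //; have := L_gt0; nra.
Qed.

(* Almost all edges [flip j v -- flip j (flip i v)] opposite to a [K]-[K] edge in a
   4-cycle would be [U]-[U] edges, which are met by [cover2]. *)
Lemma no_KK v i : ~~ parity v -> v \in K -> v \notin tcover -> flip i v \notin tcover ->
  flip i v \notin K.
Proof.
move=> pv vK vc ic; apply/negP => iK.
move: vc; rewrite inE negb_or => /andP[/notin_cover2 [v1 vd1] vd2].
move: ic; rewrite inE negb_or => /andP[/notin_cover2 [i1 id1] id2].
have [_ vX _] := notin_cover1 v1; have [_ _ iY] := notin_cover1 i1.
have hv : (8 * #|nbrs_in K v| < d)%N.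
  move: vX; rewrite inE pv /= -ltNge -(ltr_nat R) natrM vent_K // subr0; have := L_gt0; nra.
have hi : (32 * #|nbrs_in K (flip i v)| < d)%N.
  move: iY; rewrite inE parity_flip pv inE iK orbT /= -ltNge => h.
  have := le_lt_trans (slack_K iK) h; rewrite ltr_pdivrMr // => h'.
  have : #|nbrs_in K (flip i v)|%:R * L <= \sum_j (L - vent (flip j (flip i v))).
    rewrite -sum_cst_in [leLHS]big_mkcond; apply: ler_sum => j _.
    by rewrite inE; case: ifP => [/vent_K ->|_]; rewrite ?subr0 // subr_ge0 vent_nbr_K.
  by rewrite -(ltr_nat R) natrM; have := L_gt0; nra.
have [|j] := @exists_not_covered _ [:: nbrs_in K v; nbrs_in bad v; nbrs_in cover2 v;
    nbrs_in K (flip i v); nbrs_in bad (flip i v); nbrs_in cover2 (flip i v)].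
  have arith (k b1 c1 c2 k' b1' c1' c2' n : nat) : (8 * k < n -> 32 * k' < n ->
    16 * c1 < n -> 16 * c1' < n -> 16 * c2 < n -> 16 * c2' < n -> b1 <= c1 -> b1' <= c1' ->
    k + (b1 + (c2 + (k' + (b1' + (c2' + 0))))) < n)%N by clear; lia.
  exact: arith hv hi (nbrs_in_small vd1) (nbrs_in_small id1) (nbrs_in_small vd2)
    (nbrs_in_small id2) (nbrs_in_sub v bad_cover1) (nbrs_in_sub (flip i v) bad_cover1).
rewrite /= andbT => /and4P[jK jb jc /and3P[jK' jb' jc']].
have jU : flip j v \in U.
  move: jK jb; rewrite !in_nbrs_in in_setC negbK in_setU => /negPf ->.
  by rewrite orbF.
have jU' : flip j (flip i v) \in U.
  move: jK' jb'; rewrite !in_nbrs_in in_setC negbK in_setU => /negPf ->.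
  by rewrite orbF.
have {}jc : flip j v \notin cover2 by rewrite in_nbrs_in in jc.
have {}jc' : flip j (flip i v) \notin cover2 by rewrite in_nbrs_in in jc'.
have [/notin_cover1 [_ _ jY] _] := notin_cover2 jc.
have := no_UU (i := i) _ jU' jc'; rewrite flipC flipK jU !parity_flip negbK.
by move=> /(_ pv jY).
Qed.

(* The first component tells whether the even vertices near [v] are the free ones
   ([true] at a [K]-vertex of odd parity or a [U]-vertex of even parity). *)
Definition vtype v : bool * 'I_3 := (parity v (+) (v \in U), lab v).

Lemma disjointUK v : v \in U -> v \in K -> False.
Proof.
move=> vU vK; have [x xS] := card_gt0P S_gt0.
by have := U_lab vU xS; rewrite (K_lab vK xS) eqxx.
Qed.

(** Off [tcover] every edge joins [U] to [K] with equal labels, and it also changes the parity, so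
    the first component of the type is unchanged. *)
Theorem vtype_eq v i : v \notin tcover -> flip i v \notin tcover -> vtype v = vtype (flip i v).
Proof.
wlog pv : v / ~~ parity v => [H vc ic|].
  case: (boolP (parity v)) => pv; last exact: H.
  by have := H (flip i v); rewrite parity_flip pv flipK => /(_ isT ic vc).
move=> vc ic; have [v2 _] : v \notin cover2 /\ v \notin dense cover2.
  by apply/andP; rewrite -negb_or -in_setU.
have [i2 _] : flip i v \notin cover2 /\ flip i v \notin dense cover2.
  by apply/andP; rewrite -negb_or -in_setU.
have [v1 _] := notin_cover2 v2; have [i1 _] := notin_cover2 i2.
have [vUK _ _] := notin_cover1 v1; have [iUK _ iY] := notin_cover1 i1.
rewrite /vtype parity_flip (negPf pv) /=.
move: vUK; rewrite inE => /orP[vU|vK].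
  have /negPf niU := no_UU pv vU v2 iY.
  move: iUK; rewrite inE niU /= => iK.
  by rewrite vU (same_lab_UK pv vU v2 iK).
have /negPf niK := no_KK pv vK vc ic.
move: iUK; rewrite inE niK orbF => iU.
rewrite iU (same_lab_KU pv vK iU iY).
by case: (boolP (v \in U)) => // /disjointUK /(_ vK).
Qed.

(** * Type classes and the use of balance *)

Definition zeros b x : {set vertex d} := [set v | (parity v == b) && (x v == ord0)].

Definition typeclass (t : bool * 'I_3) : {set vertex d} :=
  [set v | (v \notin tcover) && (vtype v == t)].

Lemma in_typeclassE v t : (v \in typeclass t) = (v \notin tcover) && (vtype v == t).
Proof. by rewrite in_set. Qed.

Lemma typeclass_boundary t : outer_boundary (typeclass t) \subset tcover.
Proof.
apply/subsetP => v; rewrite in_set !in_typeclassE => /andP[vt /existsP[i]].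
rewrite in_typeclassE => /andP[ic /eqP it].
by apply: contraR vt => vc; rewrite vc (vtype_eq vc ic) it eqxx.
Qed.

Lemma sum_typeclass : (\sum_t #|typeclass t| + #|tcover| = 2 ^ d)%N.
Proof.
rewrite -card_vertex -(cardsC tcover) addnC; congr addn.
rewrite -sum1_card (partition_big vtype predT) //=; apply: eq_bigr => t _.
by rewrite sum1_card; apply: eq_card => v; rewrite in_typeclassE [RHS]unfold_in in_setC.
Qed.

(** Of the six classes, one has at least [2 ^+ d / 7] elements. Its boundary lies in [tcover], so
    isoperimetry bounds its complement by [7 * sqrt d * #|tcover|], and [28 * 10 ^+ 2 = 7 * 400]. *)
Lemma large_typeclass : 28 * 10 ^+ 2 * Num.sqrt d%:R * #|tcover|%:R <= 2 ^+ d :> R ->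
  exists t, 2 ^+ d - #|typeclass t|%:R <= 2 ^+ d / 400 :> R.
Proof.
move=> small; have N0 : 0 < 2 ^+ d :> R by rewrite exprn_gt0.
have d1 : 1 <= Num.sqrt d%:R :> R by rewrite -[leLHS]sqrtr1 ler_wsqrtr // ler1n.
have c0 : 0 <= #|tcover|%:R :> R by [].
have cle : #|tcover|%:R <= 2 ^+ d / (28 * 10 ^+ 2) :> R.
  by have := ler_wpM2r c0 d1; lra.
have [t ht] : exists t, 2 ^+ d / 7 <= #|typeclass t|%:R :> R.
  apply/existsP; apply: contraT; rewrite negb_exists => /forallP H.
  have : \sum_t #|typeclass t|%:R <= \sum_(t : bool * 'I_3) (2 ^+ d / 7) :> R.
    by apply: ler_sum => t _; rewrite ltW // ltNge H.
  rewrite sum_cst_in card_prod card_bool card_ord -natr_sum => h.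
  have := sum_typeclass => /(congr1 (fun n => n%:R : R)); rewrite natrD natrX => h2.
  lra.
exists t; have := isoperimetry R (typeclass t).
set a := #|typeclass t|%:R : R in ht *.
have : #|outer_boundary (typeclass t)|%:R <= #|tcover|%:R :> R.
  by rewrite ler_nat subset_leq_card // typeclass_boundary.
have s0 : 0 <= Num.sqrt d%:R :> R by rewrite sqrtr_ge0.
move=> /(ler_wpM2l s0) h1 h2.
have h3 : Num.sqrt d%:R * #|outer_boundary (typeclass t)|%:R <= 2 ^+ d / (28 * 10 ^+ 2) :> R by lra.
have h4 := ler_wpM2l (ltW N0) h3.
have aN : 0 <= 2 ^+ d - a by rewrite subr_ge0 /a -natrX ler_nat -card_vertex max_card.
have h5 := ler_wpM2r aN ht.
rewrite -(ler_pM2l N0); lra.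
Qed.

(** Weights 1/3 on colour 0 and 2/3 on the other available colour; this beats [L] when colour 0 is
    sufficiently rare. *)
Lemma vent_two_colours v : lab v != ord0 -> (forall x, x \in S -> x v != lab v) ->
  vent v <= ln 3 - L + avg (fun x => (x v == ord0)%:R) * L.
Proof.
move=> l0 H; apply: le_trans (vent_gibbs (W := fun t =>
  if t == lab v then 0 else if t == ord0 then 1/3 else 2/3) _ _ _) _.
- by move=> t; do ?case: ifP => _; lra.
- by rewrite sum_ord3 //; lra.
- by move=> x /H /negPf->; case: ifP => _; lra.
rewrite [X in _ <= _ + X]mulrC -avgZ -[X in X + _](@avg_cst R _ _ S S_gt0) -avgD.
apply: le_avg => // x /H /negPf->; case: eqP => _ /=.
  by rewrite div1r lnV ?posrE // opprK; lra.
by rewrite ln_div ?posrE // -/L; lra.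
Qed.

Lemma sum_pr_zeros (P : pred (vertex d)) b (k : R) : (forall v, P v -> parity v = b) ->
  (forall x, x \in S -> #|zeros b x|%:R <= k) ->
  \sum_(v | P v) avg (fun x => (x v == ord0)%:R) <= k.
Proof.
move=> Pb hk; rewrite -avg_sum -(@avg_cst R _ _ S S_gt0 k); apply: le_avg => x /hk.
apply: le_trans; rewrite -sum1_card natr_sum [leLHS]big_mkcond [leRHS]big_mkcond /=.
apply: ler_sum => v _; rewrite in_set; case: ifPn => [/Pb->|_]; last by case: ifP.
by rewrite eqxx; case: eqP.
Qed.

Hypothesis S_balanced : forall x b, x \in S ->
  #|zeros b x|%:R <= #|zeros (~~ b) x|%:R + 3 / 16 * 2 ^+ d :> R.

Lemma in_typeclass b l v : v \in typeclass (b, l) ->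
  lab v = l /\ if parity v == b then v \in K else v \in U.
Proof.
rewrite in_typeclassE => /andP[vc /eqP [hb hl]]; split=> //.
have [/notin_cover1 [] +] : v \notin cover1 /\ true.
  by split=> //; move: vc; rewrite !in_setU !negb_or => /andP[/andP[/andP[/andP[-> ->] ->]]].
move: hb; rewrite in_setU; case: (boolP (v \in U)) => /= vU hb h _ _.
  by rewrite -hb; case: (parity v).
by rewrite -hb; case: (parity v).
Qed.

(** If [l] is 0, nearly all of class [b] has colour 0 and nearly none of the other class does,
    against balance. Otherwise class [b] is nearly all known and almost free of 0, so by balance
    colour 0 fills little more than 3/8 of the other class, and [ln 3 - L + 3 / 8 * L] is below
    [L]. *)
Lemma ln_card_le_large_typeclass b l :
  2 ^+ d - #|typeclass (b, l)|%:R <= 2 ^+ d / 400 :> R ->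
  ln #|S|%:R <= 99 / 100 * (2 ^+ d / 2 * L).
Proof.
set A := typeclass (b, l) => hA.
have N0 : 0 < 2 ^+ d :> R by rewrite exprn_gt0.
have hC : #|~: A|%:R <= 2 ^+ d / 400 :> R.
  apply: le_trans hA; rewrite lerBrDr addrC -natrD cardsC -natrX ler_nat.
  by rewrite -card_vertex.
have inA v : v \in A -> lab v = l /\ if parity v == b then v \in K else v \in U.
  exact: in_typeclass.
case: (eqVneq l ord0) => [l0|l0].
  have [x xS] := card_gt0P S_gt0; exfalso.
  have z1 : 2 ^+ d / 2 - 2 ^+ d / 400 <= #|zeros b x|%:R :> R.
    rewrite lerBlDr -(card_parityR b) (le_trans _ (lerD (lexx _) hC)) // -natrD ler_nat.
    apply: leq_trans (_ : #|zeros b x :|: ~: A| <= _)%N; last exact: (leq_card_setU _ _).1.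
    apply/subset_leq_card/subsetP => v; rewrite inE => pv; rewrite in_setU in_set pv /= in_setC.
    case: (boolP (v \in A)) => [/inA [vl]|_]; last by rewrite orbT.
    by rewrite pv => /K_lab -> //; rewrite vl l0 eqxx.
  have z2 : #|zeros (~~ b) x|%:R <= 2 ^+ d / 400 :> R.
    apply: le_trans hC; rewrite ler_nat; apply/subset_leq_card/subsetP => v.
    rewrite in_set in_setC => /andP[pv xv]; apply/negP => /inA [vl].
    have -> : (parity v == b) = false by rewrite (eqP pv); case: (b).
    by move=> /U_lab /(_ xS); rewrite vl l0 xv.
  have := S_balanced b xS; lra.
have zb x : x \in S -> #|zeros b x|%:R <= 2 ^+ d / 400 :> R.
  move=> xS; apply: le_trans hC; rewrite ler_nat; apply/subset_leq_card/subsetP => v.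
  rewrite in_set in_setC => /andP[pv xv]; apply/negP => /inA [vl].
  by rewrite pv => /K_lab /(_ xS) xl; rewrite -vl -xl xv in l0.
have znb x : x \in S -> #|zeros (~~ b) x|%:R <= (2 ^+ d / 400 + 3 / 16 * 2 ^+ d : R).
  by move=> xS; have := S_balanced (~~ b) xS; rewrite negbK; have := zb x xS; lra.
rewrite -(entT R S_gt0).
have -> : [set: vertex d] = [set v in enum (vertex d)].
  by apply/setP => v; rewrite !inE mem_enum.
apply: le_trans (ent_subadd R S_gt0 _) _.
rewrite big_enum /= (bigID (mem A)) /=.
rewrite [X in X + _](bigID (fun v => parity v == b)) /= [X in X + _ + _]big1 ?add0r; last first.
  by move=> v /andP[/inA [_ +] pv]; rewrite pv => /vent_K.
have L1 := ln3_le R; rewrite -/L in L1.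
have l30 : 0 <= ln 3 - L :> R by rewrite subr_ge0 ler_ln ?posrE //; lra.
have b1 : \sum_(v | v \notin A) ent [set v] <= 2 ^+ d / 400 * ln 3.
  apply: le_trans (_ : \sum_(v in ~: A) ln 3 <= _).
    rewrite [leRHS](eq_bigl (fun v => v \notin A)) => [|v]; last by rewrite in_setC.
    by apply: ler_sum => v _; exact: vent_le_ln3.
  by rewrite sum_cst_in ler_wpM2r // ln_ge0 //; lra.
have b2 : \sum_(v | (v \in A) && (parity v != b)) ent [set v]
    <= 2 ^+ d / 2 * (ln 3 - L) + (2 ^+ d / 400 + 3 / 16 * 2 ^+ d) * L.
  apply: le_trans (_ : \sum_(v | (v \in A) && (parity v != b))
     (ln 3 - L + avg (fun x => (x v == ord0)%:R) * L) <= _).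
    apply: ler_sum => v /andP[/inA [vl +] /negPf pv]; rewrite pv => vU.
    by apply: vent_two_colours => [|x]; [rewrite vl | exact: U_lab].
  rewrite big_split /= -mulr_suml; apply: lerD.
    rewrite -(card_parityR (~~ b)) sum_cst_in ler_wpM2r // ler_nat.
    by apply/subset_leq_card/subsetP => v; rewrite !inE => /andP[_]; case: (parity v); case: (b).
  rewrite ler_wpM2r ?(ltW L_gt0) //; apply: (@sum_pr_zeros _ (~~ b)) => // v /andP[_].
  by case: (parity v); case: (b).
have h1 := ler_wpM2l (ltW N0) L1; have h2 := mulr_gt0 N0 L_gt0.
lra.
Qed.

Lemma ln_card_le_small_tcover : 28 * 10 ^+ 2 * Num.sqrt d%:R * #|tcover|%:R <= 2 ^+ d :> R ->
  ln #|S|%:R <= 99 / 100 * (2 ^+ d / 2 * L).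
Proof. by move=> /large_typeclass [[b l]]; exact: ln_card_le_large_typeclass. Qed.

End LocalStructure.

(** * Sampling and the number of balanced colourings *)

(** Here [N = 2 ^+ d], [s = sqrt d], [b = #|bad|], [c = #|tcover|] and [S] is the logarithm of the
    size of the class. If [S] were larger, the deficit would be at most [6 * N / (P * s)], forcing
    [c] below the assumed lower bound. *)
Lemma deficit_arith (R : realType) (N s P L b c S : R) :
  0 < N -> 28 * 10 ^+ 2 * (289 * 500) <= P -> P <= s -> 1 / 2 <= L <= 3 / 4 -> 0 <= b ->
  b * (s ^+ 2) ^+ 2 <= N ->
  c * L <= 289 * (b * L + 40 * (N / 2 * (L + L / s ^+ 2) + 4 * b - S)) ->
  N < 28 * 10 ^+ 2 * s * c -> S <= N / 2 * L - N / s / P.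
Proof.
move=> N0 P0 Ps /andP[L1 L2] b0 hb hc hN; rewrite leNgt; apply/negP => hS.
have P1 : 1 <= P by lra.
have Px x : 0 <= x -> 28 * 10 ^+ 2 * (289 * (500 * x)) <= P * x.
  by move=> /ler_wpM2r /(_ _ _ P0); rewrite !mulrA.
clear P0.
have s0 : 0 < s by lra.
have [e eE] : exists e, N = P * e by exists (N / P); rewrite mulrC divfK // lt0r_neq0 //; lra.
have e0 : 0 < e by rewrite eE pmulr_rgt0 in N0; lra.
have Nse : N / s <= e by rewrite ler_pdivrMr // eE mulrC ler_wpM2l // ltW.
have hsb : s * b <= e.
  apply: le_trans Nse; rewrite ler_pdivlMr //.
  have h1 : 1 <= s ^+ 2 by apply: exprn_ege1; lra.
  have h2 : 0 <= b * s ^+ 2 by rewrite mulr_ge0 ?sqr_ge0.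
  have := ler_wpM2l h2 h1; rewrite mulr1 => h3; rewrite (_ : s * b * s = b * s ^+ 2); last by ring.
  by apply: le_trans h3 _; rewrite -mulrA -expr2.
have hD : s * (N / 2 * (L + L / s ^+ 2) + 4 * b - S) <= 6 * e.
  have h1 : s * (N / 2 * (L + L / s ^+ 2) + 4 * b - S)
      <= s * (N / 2 * (L / s ^+ 2) + 4 * b + N / s / P).
    by rewrite ler_wpM2l ?(ltW s0) //; lra.
  apply: le_trans h1 _.
  have -> : s * (N / 2 * (L / s ^+ 2) + 4 * b + N / s / P) =
     N / s * (L / 2) + 4 * (s * b) + N / P by field; rewrite !lt0r_neq0 //; lra.
  have -> : N / P = e by rewrite eE mulrAC divff ?mul1r // lt0r_neq0 //; lra.
  have : N / s * (L / 2) <= e * 1.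
    by apply: ler_pM => //; [rewrite divr_ge0 // ltW | lra | lra].
  lra.
have L0 : 0 < L by lra.
set D := _ - S in hD hc.
have h1 : s * c * L <= 289 * (s * b * L + 40 * (s * D)).
  have -> : s * c * L = s * (c * L) by ring.
  have -> : 289 * (s * b * L + 40 * (s * D)) = s * (289 * (b * L + 40 * D)) by ring.
  by rewrite ler_wpM2l // ltW.
have h2 : N * L < 28 * 10 ^+ 2 * (s * c * L) by rewrite mulrA ltr_pM2r // mulrA.
have h3 : s * b * L <= e * L by rewrite ler_wpM2r // ltW.
have h4 : e * (1 / 2) <= e * L by rewrite ler_wpM2l // ltW.
have := Px (e * L) (mulr_ge0 (ltW e0) (ltW L0)); clear Px.
rewrite (_ : P * (e * L) = N * L); last by rewrite eE mulrA.
move: h1 h2 h3 h4 hD e0; clear.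
move: (s * c * L) (s * b * L) (s * D) (e * L) (N * L) => A B C E F; lra.
Qed.

Lemma ln_card_class_le (R : realType) (d : nat) (S : {set {ffun vertex d -> 'I_3}})
    (U K : {set vertex d}) (lab : vertex d -> 'I_3) :
  (0 < #|S|)%N ->
  (forall x v i, x \in S -> x (flip i v) != x v) ->
  (forall x v, v \in U -> x \in S -> x v != lab v) ->
  (forall x v, v \in U -> x \in S -> (#|[set i | x (flip i v) != lab v]| * 128 <= d)%N) ->
  (forall x v, v \in K -> x \in S -> x v = lab v) ->
  (forall x b, x \in S ->
    #|zeros b x|%:R <= #|zeros (~~ b) x|%:R + 3 / 16 * 2 ^+ d :> R) ->
  #|~: (U :|: K)|%:R * d%:R ^+ 2 <= 2 ^+ d :> R ->
  10 ^+ 9 <= Num.sqrt d%:R :> R ->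
  ln #|S|%:R <= 2 ^+ d / 2 * ln 2 - 2 ^+ d / Num.sqrt d%:R / 10 ^+ 9 :> R.
Proof.
move=> S0 S_proper U_lab U_nbr K_lab S_bal hbad hs.
have N0 : 0 < 2 ^+ d :> R by rewrite exprn_gt0.
have P0 : 28 * 10 ^+ 2 * (289 * 500) <= 10 ^+ 9 :> R by lra.
have dE : d%:R = Num.sqrt d%:R ^+ 2 :> R by rewrite sqr_sqrtr.
have d_gt0 : (0 < d)%N.
  rewrite lt0n; apply: contraTneq hs => ->; rewrite sqrtr0 -ltNge; exact: exprn_gt0.
(* A large [tcover] forces a large deficit; a small one leaves a single dominant type, where the
   balance argument applies. *)
have [small|] := lerP (28 * 10 ^+ 2 * Num.sqrt d%:R * #|@tcover R d S U K|%:R : R) (2 ^+ d); last first.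
  apply: (deficit_arith N0 P0 hs _ (ler0n _ #|~: (U :|: K)|)).
  - by rewrite ln2_ge ln2_le.
  - by rewrite -dE.
  - by rewrite -dE; exact: (card_tcover_le R d_gt0 S0 S_proper U_lab U_nbr K_lab).
apply: le_trans (ln_card_le_small_tcover d_gt0 S0 S_proper U_lab U_nbr K_lab S_bal small) _.
move: hs N0 P0 (ln2_ge R); move: (10 ^+ 9 : R) (Num.sqrt d%:R) (2 ^+ d) (ln 2).
move=> P s N L Ps N0 P0 L1; have P1 : 400 <= P by lra.
clear -Ps N0 P1 L1.
have h : N / s / P <= N / 400.
  have s1 : 1 <= s by lra.
  have sP : 400 <= s * P by have := ler_wpM2r (le_trans (ler0n R 400) P1) s1; lra.
  rewrite -mulrA -invfM; apply: ler_wpM2l; first exact: ltW.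
  by rewrite lef_pV2 // posrE; lra.
have := ler_wpM2l (ltW N0) L1; lra.
Qed.

Section Sampling.
Variables (R : realType) (d t : nat).
Implicit Types (x : {ffun vertex d -> 'I_3}) (v : vertex d) (w : {ffun 'I_t -> vertex d}).

Definition seen w x v c : bool :=
  [exists j, [exists i, w j == flip i v] && (x (w j) == c)].

Definition colnbrs x v c : {set 'I_d} := [set i | x (flip i v) == c].

(* If [v] is not in [badset w x] and only one colour is seen at [v], each of the two
   other colours is carried by fewer than [d / 256] of its neighbours. *)
Definition badset w x : {set vertex d} :=
  [set v | [exists c, (d <= 256 * #|colnbrs x v c|)%N && ~~ seen w x v c]].

(** Samples are ordered with repetition, so the count is an exact power, bounded by
    [1 - q <= expR (- q)] with [q] the density of [Q]. *)
Lemma card_avoiding (Q : {set vertex d}) :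
  #|[set w : {ffun 'I_t -> vertex d} | [forall j, w j \notin Q]]|%:R
    <= (2 ^+ d) ^+ t * expR (- (#|Q|%:R * t%:R / 2 ^+ d)) :> R.
Proof.
have -> : #|[set w : {ffun 'I_t -> vertex d} | [forall j, w j \notin Q]]| = (#|~: Q| ^ t)%N.
  rewrite -[X in (_ ^ X)%N](card_ord t) -card_ffun_on; apply: eq_card => w.
  by rewrite inE; apply: eq_forallb => j; rewrite inE.
have N0 : 0 < 2 ^+ d :> R by rewrite exprn_gt0.
have -> : - (#|Q|%:R * t%:R / 2 ^+ d) = t%:R * - (#|Q|%:R / 2 ^+ d) :> R by ring.
rewrite expRM_natl -exprMn natrX lerXn2r ?nnegrE ?mulr_ge0 ?expR_ge0 ?(ltW N0) //.
have -> : #|~: Q|%:R = 2 ^+ d * (1 + - (#|Q|%:R / 2 ^+ d)) :> R.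
  rewrite cardsCs setCK card_vertex natrB ?natrX; last by rewrite -card_vertex max_card.
  by field; rewrite lt0r_neq0.
by rewrite ler_wpM2l ?(ltW N0) ?expR_ge1Dx.
Qed.

(** Union bound over the vertices and the three colours, with [Q] the set of neighbours of [v] of
    colour [c]. *)
Lemma sum_card_badset x :
  \sum_w #|badset w x|%:R <=
    (2 ^+ d) ^+ t * (3 * 2 ^+ d * expR (- (d%:R * t%:R / (256 * 2 ^+ d)))) :> R.
Proof.
set E := expR _; have N0 : 0 < 2 ^+ d :> R by rewrite exprn_gt0.
pose bad1 w v c := (d <= 256 * #|colnbrs x v c|)%N && ~~ seen w x v c.
have h w : #|badset w x|%:R <= \sum_v \sum_c (bad1 w v c)%:R :> R.
  rewrite -sum1_card natr_sum [leLHS]big_mkcond; apply: ler_sum => v _.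
  rewrite inE; case: existsP => [[c bc]|_]; last by rewrite sumr_ge0.
  by rewrite (bigD1 c) //= /bad1 bc lerDl sumr_ge0.
apply: le_trans (ler_sum _ (fun w _ => h w)) _.
rewrite exchange_big /=.
have -> : (2 ^+ d) ^+ t * (3 * 2 ^+ d * E) =
   \sum_(v : vertex d) \sum_(c : 'I_3) ((2 ^+ d) ^+ t * E).
  rewrite sum_cst_ord sum_cst_in card_vertex natrX; ring.
apply: ler_sum => v _; rewrite exchange_big /=; apply: ler_sum => c _.
case: (leqP d (256 * #|colnbrs x v c|)) => hd; last first.
  rewrite big1 => [|w _]; first by rewrite mulr_ge0 ?expR_ge0 // exprn_ge0 // ltW.
  by rewrite /bad1 leqNgt hd.
pose Q := [set flip i v | i in colnbrs x v c].
have cQ : #|Q| = #|colnbrs x v c|.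
  by apply: card_imset => i j /eqP; rewrite flip_eq => /eqP.
apply: le_trans (_ : #|[set w : {ffun 'I_t -> vertex d} | [forall j, w j \notin Q]]|%:R <= _).
  rewrite -[in leRHS]sum1_card natr_sum [leRHS]big_mkcond; apply: ler_sum => w _.
  rewrite inE; case: forallP => [_|nQ].
    by rewrite ler_nat leq_b1.
  rewrite /bad1 (_ : seen w x v c) ?andbF //; apply/contraT => ns; case: nQ => j.
  apply: contra ns => /imsetP [i]; rewrite inE => xi wj.
  by apply/existsP; exists j; rewrite wj xi andbT; apply/existsP; exists i.
apply: le_trans (card_avoiding Q) _.
rewrite ler_wpM2l ?exprn_ge0 ?(ltW N0) // ler_expR lerN2 cQ.
have -> : d%:R * t%:R / (256 * 2 ^+ d) = d%:R * (t%:R / (256 * 2 ^+ d)) :> R by ring.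
have -> : #|colnbrs x v c|%:R * t%:R / 2 ^+ d =
    (256 * #|colnbrs x v c|)%:R * (t%:R / (256 * 2 ^+ d)) :> R.
  by rewrite natrM; field; rewrite lt0r_neq0.
apply: ler_wpM2r; last by rewrite ler_nat.
apply: divr_ge0; first exact: ler0n.
by apply: mulr_ge0; [exact: ler0n | exact: ltW].
Qed.

(** Averaging gives a sample whose mean bad set over [B] is no larger than expected; by Markov's
    inequality at least half of [B] stays within twice that bound. *)
Lemma exists_good_sample (B : {set {ffun vertex d -> 'I_3}}) :
  exists w, #|B|%:R <= 2 * #|[set x in B | #|badset w x|%:R <=
      6 * 2 ^+ d * expR (- (d%:R * t%:R / (256 * 2 ^+ d))) :> R ]|%:R :> R.
Proof.
set E := expR _; have E0 : 0 < E by exact: expR_gt0.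
have N0 : 0 < 2 ^+ d :> R by rewrite exprn_gt0.
pose F w : R := \sum_(x in B) #|badset w x|%:R.
have [w hw] : exists w, F w <= #|B|%:R * (3 * 2 ^+ d * E).
  apply/existsP; apply: contraT; rewrite negb_exists => /forallP H.
  have : \sum_w F w <= \sum_(x in B) ((2 ^+ d) ^+ t * (3 * 2 ^+ d * E)).
    by rewrite exchange_big /=; apply: ler_sum => x _; exact: sum_card_badset.
  have : \sum_(w : {ffun 'I_t -> vertex d}) (#|B|%:R * (3 * 2 ^+ d * E)) < \sum_w F w.
    apply: ltr_sum => [|w _]; last by rewrite ltNge H.
    by apply/hasP; exists [ffun=> [ffun=> true]]; rewrite ?mem_index_enum.
  rewrite !sum_cst_in card_ffun card_vertex card_ord !natrX.
  by move=> h1 h2; have := lt_le_trans h1 h2; rewrite mulrCA ltxx.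
exists w; set A := [set x in B | _].
have h1 : #|B :\: A|%:R * (6 * 2 ^+ d * E) <= F w.
  rewrite -sum_cst_in [leLHS]big_mkcond /F [leRHS]big_mkcond; apply: ler_sum => x _.
  rewrite !inE; case: (x \in B) => //=; rewrite ?andbF // andbT.
  by case: ifPn => //; rewrite -ltNge => /ltW.
have h2 : #|B|%:R = #|A|%:R + #|B :\: A|%:R :> R.
  rewrite -natrD -(cardsID A B) (_ : B :&: A = A) //; apply/setIidPr/subsetP => x.
  by rewrite inE => /andP[].
have NE : 0 < 2 ^+ d * E by rewrite mulr_gt0.
rewrite -(ler_pM2r NE); have := mulr_ge0 (ler0n R #|B :\: A|) (ltW NE); nra.
Qed.

(** A set of size at most [k] is listed by a function on ['I_k], with [None] as padding. *)
Lemma card_small_sets (T : finType) k :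
  (#|[set b : {set T} | #|b| <= k]| <= #|T|.+1 ^ k)%N.
Proof.
pose f (g : {ffun 'I_k -> option T}) : {set T} := [set v | [exists j, g j == Some v]].
apply: leq_trans (_ : #|f @: [set: {ffun 'I_k -> option T}]| <= _)%N; last first.
  by rewrite (leq_trans (leq_imset_card _ _)) // cardsT card_ffun card_option card_ord.
apply/subset_leq_card/subsetP => b; rewrite inE => bk; apply/imsetP.
exists [ffun j : 'I_k => nth None (map Some (enum b)) j] => //.
apply/setP => v; rewrite inE; apply/idP/existsP => [vb|[j]].
  have vk : (index v (enum b) < k)%N.
    by apply: leq_trans bk; rewrite cardE index_mem mem_enum.
  exists (Ordinal vk); rewrite ffunE /= (nth_map v) ?index_mem ?mem_enum //.
  by rewrite nth_index ?mem_enum.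
rewrite ffunE => /eqP; case: (ltnP j (size (enum b))) => hj.
  by rewrite (nth_map v) // => -[<-]; rewrite -mem_enum mem_nth.
by rewrite nth_default // size_map.
Qed.

Definition balanced x : bool := [forall b : bool,
  #|zeros b x|%:R <= #|zeros (~~ b) x|%:R + 3 / 16 * 2 ^+ d :> R].

Definition balanced_colorings : {set {ffun vertex d -> 'I_3}} :=
  [set x | proper_coloring x & balanced x].

Lemma proper_flip x v i : proper_coloring x -> x (flip i v) != x v.
Proof.
move=> /forallP /(_ (flip i v)) /forallP /(_ v) /implyP; apply.
by apply/adjacentP; exists i; rewrite flipK.
Qed.

Definition sample w x : {ffun 'I_t -> 'I_3} := [ffun j => x (w j)].

Lemma seen_sample w x y : sample w x = sample w y -> seen w x =2 seen w y.
Proof.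
move=> /ffunP h v c; apply: eq_existsb => j; congr (_ && _).
by have := h j; rewrite !ffunE => ->.
Qed.

Lemma seen_neq w x v c : proper_coloring x -> seen w x v c -> x v != c.
Proof.
by move=> px /existsP [j /andP[/existsP [i /eqP ->] /eqP <-]]; rewrite eq_sym proper_flip.
Qed.

Lemma ln_card_sample_class w (b : {set vertex d}) (kappa : {ffun 'I_t -> 'I_3}) :
  let S := [set x in balanced_colorings | (sample w x == kappa) && (badset w x == b)] in
  #|b|%:R * d%:R ^+ 2 <= 2 ^+ d :> R -> 10 ^+ 9 <= Num.sqrt d%:R :> R ->
  #|S|%:R <= expR (2 ^+ d / 2 * ln 2 - 2 ^+ d / Num.sqrt d%:R / 10 ^+ 9) :> R.
Proof.
move=> S hb hd.
case: (set_0Vmem S) => [->|[x0 x0S]]; first by rewrite cards0 expR_ge0.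
have S0 : (0 < #|S|)%N by apply/card_gt0P; exists x0.
rewrite -[leLHS]lnK ?posrE ?ltr0n // ler_expR.
have Sprop x : x \in S -> proper_coloring x by rewrite !inE => /andP[/andP[]].
have Sseen x : x \in S -> seen w x =2 seen w x0.
  move=> xS; apply: seen_sample; move: xS x0S; rewrite !inE.
  by move=> /andP[_ /andP[/eqP -> _]] /andP[_ /andP[/eqP -> _]].
have Sbad x : x \in S -> badset w x = b by rewrite inE => /andP[_ /andP[_ /eqP]].
have d_gt0 : (0 < d)%N.
  rewrite lt0n; apply: contraTneq hd => ->; rewrite sqrtr0 -ltNge exprn_gt0 //.
(* [K] collects the vertices whose colour is forced to be the third one. A vertex of [U] sees at
   most one colour, and [labU] shows that it sees exactly one, which becomes its label. *)
pose K := [set v | [exists c, exists c', [&& c != c', seen w x0 v c & seen w x0 v c']]].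
pose U := [set v | (v \notin K) && (v \notin b)].
pose lab v := if v \in K then x0 v else odflt ord0 [pick c | seen w x0 v c].
have labU v : v \in U -> seen w x0 v (lab v).
  rewrite in_set => /andP[/negPf vK vb]; rewrite /lab vK; case: pickP => //= ns.
  case/negP: vb; rewrite -(Sbad _ x0S) inE.
  (* The three colours share [d] neighbours, so some colour reaches the threshold; as [v] is not in
     [b], that colour is seen. *)
  have [c hc] : exists c, (d <= 256 * #|colnbrs x0 v c|)%N.
    apply/existsP; apply: contraT; rewrite negb_exists => /forallP H.
    have : (\sum_(c < 3) 256 * #|colnbrs x0 v c| <= \sum_(c < 3) d)%N.
      by apply: leq_sum => c _; have := H c; rewrite -ltnNge => /ltnW.
    rewrite -big_distrr sum_nat_const card_ord /=.
    have -> : (\sum_(c < 3) #|colnbrs x0 v c| = d)%N.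
      rewrite -[RHS](card_ord d) -sum1_card (partition_big (fun i => x0 (flip i v)) predT) //=.
      by apply: eq_bigr => c _; rewrite sum1_card; apply: eq_card => i; rewrite !inE.
    by rewrite leq_pmul2r.
  by apply/existsP; exists c; rewrite hc ns.
apply: (@ln_card_class_le R d S U K lab) => //.
- by move=> x v i /Sprop; exact: proper_flip.
- move=> x v vU xS; apply: (seen_neq (w := w) (Sprop _ xS)).
  by rewrite Sseen // labU.
- move=> x v vU xS.
  (* A frequent second colour would be seen, since [v] is not in [b], and would put [v] in [K]. The
     two other colours together give [d / 128]. *)
  have hc c : c != lab v -> (256 * #|colnbrs x v c| <= d)%N.
    move=> cl; move: (vU); rewrite in_set => /andP[vK vb].
    rewrite leqNgt; apply: contra vb => /ltnW hc; rewrite -(Sbad _ xS) inE.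
    apply/existsP; exists c; rewrite hc /= Sseen //; apply: contra vK => sc.
    rewrite inE; apply/existsP; exists c; apply/existsP; exists (lab v).
    by rewrite cl sc labU.
  have -> : #|[set i | x (flip i v) != lab v]| = (\sum_(c < 3 | c != lab v) #|colnbrs x v c|)%N.
    rewrite -sum1_card (partition_big (fun i => x (flip i v)) (fun c => c != lab v)) /=; last first.
      by move=> i; rewrite inE.
    apply: eq_bigr => c cl; rewrite sum1_card; apply: eq_card => i.
    by rewrite [LHS]unfold_in !inE andbC; case: eqP => [->|]; rewrite ?cl.
  have : (\sum_(c < 3 | c != lab v) 256 * #|colnbrs x v c| <= \sum_(c < 3 | c != lab v) d)%N.
    exact: leq_sum.
  rewrite -big_distrr sum_nat_const /= (_ : #|_| = 2)%N; last first.
    by have := cardC1 (lab v); rewrite card_ord.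
  by move: (\sum_(i < 3 | _) _)%N => m; clear; lia.
- move=> x v vK xS; rewrite /lab vK; move: vK; rewrite inE.
  move=> /existsP [c /existsP [c' /and3P[cc sc sc']]].
  apply: (ord3_third cc); rewrite ?(seen_neq _ sc) ?(seen_neq _ sc') ?Sprop //;
  by apply: (@seen_neq w); rewrite ?Sprop ?Sseen.
- by move=> x b'; rewrite !inE => /andP[/andP[_ /forallP /(_ b')]].
- apply: le_trans hb; rewrite ler_wpM2r ?exprn_ge0 // ler_nat.
  apply/subset_leq_card/subsetP => v; rewrite in_setC in_setU negb_or in_set.
  by move=> /andP[+ /negPf vK]; rewrite vK /= negbK.
Qed.

End Sampling.

Lemma ln6sqr_le (R : realType) (z : R) : 1 <= z -> ln (6 * (z ^+ 4) ^+ 2) <= 11 * z.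
Proof.
move=> z1; have z0 : 0 < z by lra.
rewrite lnM ?posrE ?exprn_gt0 // -exprM lnXn //.
have h6 : ln 6 <= ln (2 ^+ 3) :> R by rewrite ler_ln ?posrE ?exprn_gt0 //; lra.
rewrite lnXn // in h6; have L2 := ln2_le R.
have := ln_le_subr1 z0; rewrite /muln /=; lra.
Qed.

(** Here [N = 2 ^+ d], [z] is the fourth root of [d], [t] the sample size and [k] the size allowed
    for the bad set. Revealing both costs [O(N / z ^+ 3)], at most half of the gain [N / z ^+ 2 / P]
    as soon as [z >= 10 ^+ 4 * P]. *)
Lemma sampling_arith (R : realType) (N z P L l3 t k D : R) :
  0 < N -> 1 <= P -> 10 ^+ 4 * P <= z -> z ^+ 4 <= N -> 1 / 2 <= L <= 3 / 4 ->
  0 <= l3 <= 8 / 5 * L -> 0 <= t <= 256 * N * D / z ^+ 4 + 1 -> D <= 11 * z ->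
  0 <= k <= N / (z ^+ 4) ^+ 2 ->
  L + (t * l3 + (k * ((z ^+ 4 + 1) * L) + (N / 2 * L - N / z ^+ 2 / P)))
    <= N / 2 * L - N / z ^+ 2 / (2 * P).
Proof.
move=> N0 P1 hz zN /andP[L1 L2] /andP[l30 l3L] /andP[t0 ht] hD /andP[k0 hk].
have z1 : 1 <= z by lra.
have z0 : 0 < z by lra.
have zn n : 0 < z ^+ n by rewrite exprn_gt0.
have zu : z \is a GRing.unit by rewrite unitfE lt0r_neq0.
have [u uE] : exists u, N = u * z ^+ 3.
  by exists (N / z ^+ 3); rewrite divfK // lt0r_neq0.
have u0 : 0 < u by rewrite uE pmulr_lgt0 in N0.
have u1 : 1 <= u.
  rewrite -(ler_pM2r (zn 3)) -uE mul1r; apply: le_trans zN.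
  by rewrite exprS ler_peMl // ltW.
have z40 : z ^+ 4 != 0 by rewrite lt0r_neq0.
have ht1 : t <= (256 * 11 + 1) * u.
  apply: le_trans ht _; have : 256 * N * D / z ^+ 4 <= 256 * N * (11 * z) / z ^+ 4.
    apply: ler_wpM2r; first by rewrite invr_ge0 ltW.
    by apply: ler_wpM2l; [apply: mulr_ge0; [exact: ler0n | exact: ltW] | exact: hD].
  have -> : 256 * N * (11 * z) / z ^+ 4 = 256 * 11 * u.
    by rewrite uE; field; rewrite lt0r_neq0.
  lra.
have hk1 : k * ((z ^+ 4 + 1) * L) <= 2 * u.
  have z41 : 1 <= z ^+ 4 by apply: exprn_ege1.
  have h1 : 0 <= (z ^+ 4 + 1) * L by rewrite mulr_ge0; lra.
  have h2 : (z ^+ 4 + 1) * L <= 2 * z ^+ 4.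
    have := ler_wpM2l (ltW (zn 4)) L2; lra.
  apply: le_trans (ler_pM k0 h1 hk h2) _.
  have -> : N / (z ^+ 4) ^+ 2 * (2 * z ^+ 4) = 2 * u / z.
    by rewrite uE; field; rewrite lt0r_neq0.
  by rewrite ler_pdivrMr // ler_peMr // mulr_ge0 // ltW.
have l31 : l3 <= 6 / 5 by lra.
have ht2 := ler_pM t0 l30 ht1 l31.
have hP : 10 ^+ 4 * u <= N / z ^+ 2 / P.
  have -> : N / z ^+ 2 = u * z by rewrite uE; field; rewrite lt0r_neq0.
  rewrite ler_pdivlMr; last by lra.
  by rewrite mulrAC mulrC; apply: ler_wpM2l => //; exact: ltW.
have -> : N / z ^+ 2 / (2 * P) = N / z ^+ 2 / P / 2.
  by field; rewrite !lt0r_neq0 //; lra.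
move: ht2 hk1 hP u1 L2; move: (N / z ^+ 2 / P) (N / 2 * L) (k * _) (t * l3) => A B C E.
clear; lra.
Qed.

(** At least half of the balanced colourings have a small bad set for a good sample; these are split
    according to the colours of the sample and the bad set, and each class is bounded by
    [ln_card_sample_class]. *)
Lemma card_balanced_colorings (R : realType) (d : nat) :
  10 ^+ 13 <= Num.sqrt (Num.sqrt d%:R) :> R ->
  #|balanced_colorings R d|%:R
    <= expR (2 ^+ d / 2 * ln 2 - 2 ^+ d / Num.sqrt d%:R / (2 * 10 ^+ 9)) :> R.
Proof.
set z : R := Num.sqrt (Num.sqrt d%:R) => hz.
have P1 : 1 <= 10 ^+ 9 :> R by apply: exprn_ege1; lra.
have hzP : 10 ^+ 4 * 10 ^+ 9 <= z by apply: le_trans hz; rewrite -exprD.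
have z1 : 1 <= z by apply: le_trans hz; apply: exprn_ege1; lra.
have sz : 10 ^+ 9 <= Num.sqrt d%:R :> R.
  rewrite -(sqr_sqrtr (sqrtr_ge0 d%:R)) -/z expr2; apply: le_trans (_ : z * 1 <= _).
    rewrite mulr1; apply: le_trans hzP; rewrite ler_peMl ?exprn_ege1 //; lra.
  by rewrite ler_wpM2l // sqrtr_ge0.
have sE : Num.sqrt d%:R = z ^+ 2 by rewrite sqr_sqrtr ?sqrtr_ge0.
have dE : d%:R = z ^+ 4 by rewrite -(sqr_sqrtr (ler0n R d)) sE -exprM.
have d_gt0 : (0 < d)%N by rewrite -(ltr0n R) dE exprn_gt0 //; lra.
have dR_gt0 : 0 < d%:R :> R by rewrite ltr0n.
have [N NE] : exists N : R, N = 2 ^+ d by exists (2 ^+ d).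
have N0 : 0 < N by rewrite NE exprn_gt0.
have [D DE] : exists D : R, D = ln (6 * d%:R ^+ 2) by exists (ln (6 * d%:R ^+ 2)).
have D11 : D <= 11 * z by rewrite DE dE; exact: ln6sqr_le.
have D0 : 0 <= D.
  by rewrite DE ln_ge0 // -natrX -natrM ler1n muln_gt0 expn_gt0 d_gt0.
have X0 : 0 <= 256 * N * D / d%:R.
  apply: divr_ge0; last exact: ltW.
  by apply: mulr_ge0; [apply: mulr_ge0; [exact: ler0n | exact: ltW] | exact: D0].
have Y0 : 0 <= N / d%:R ^+ 2 by apply: divr_ge0; rewrite ?exprn_ge0 // ltW.
(* With [D = ln (6 * d ^+ 2)], this [t] brings the bound of [exists_good_sample] down to
   [N / d ^+ 2], the size of bad set that [ln_card_sample_class] tolerates. *)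
have [t tX tX1] : exists2 t : nat, 256 * N * D / d%:R < t%:R & t%:R <= 256 * N * D / d%:R + 1.
  exists (Num.truncn (256 * N * D / d%:R)).+1; have /andP[h1 h2] := truncn_itv X0 => //.
  by rewrite -natr1 lerD2r.
have [k kN kN'] : exists2 k : nat, k%:R <= N / d%:R ^+ 2 &
    forall m : nat, m%:R <= N / d%:R ^+ 2 -> (m <= k)%N.
  exists (Num.truncn (N / d%:R ^+ 2)); have /andP[h1 h2] := truncn_itv Y0 => // m hm.
  by rewrite -ltnS -(ltr_nat R) (le_lt_trans hm).
have [w] := @exists_good_sample R d t (balanced_colorings R d).
have [E EE] : exists E : R, E = expR (- (d%:R * t%:R / (256 * 2 ^+ d))).
  by exists (expR (- (d%:R * t%:R / (256 * 2 ^+ d)))).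
rewrite -EE => hw.
have hE : 6 * 2 ^+ d * E <= N / d%:R ^+ 2.
  have p6 : 0 < 6 * d%:R ^+ 2 :> R by rewrite mulr_gt0 // exprn_gt0.
  have : E <= (6 * d%:R ^+ 2)^-1.
    rewrite EE -[leRHS]lnK ?posrE ?invr_gt0 // lnV ?posrE // -DE -NE ler_expR lerN2.
    move: (ltW tX); rewrite ler_pdivrMr // => h.
    rewrite ler_pdivlMr; last by apply: mulr_gt0; [exact: ltr0Sn | exact: N0].
    by rewrite mulrC [leRHS]mulrC.
  rewrite -NE; have h6 : 0 <= 6 * N by apply: mulr_ge0; [exact: ler0n | exact: ltW].
  move=> /(ler_wpM2l h6) /le_trans; apply.
  rewrite le_eqVlt; apply/orP; left; apply/eqP; field.
  by rewrite lt0r_neq0.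
have [beta bE] : exists b : R, b = N / 2 * ln 2 - N / Num.sqrt d%:R / 10 ^+ 9.
  by exists (N / 2 * ln 2 - N / Num.sqrt d%:R / 10 ^+ 9).
pose small := [set b : {set vertex d} | (#|b| <= k)%N].
have hB : #|balanced_colorings R d|%:R <= 2 * (3 ^+ t * ((N + 1) ^+ k * expR beta)).
  apply: le_trans hw _; rewrite ler_wpM2l //; set A := [set x in _ | _].
  pose cls kappa b := [set x in balanced_colorings R d | (sample w x == kappa) && (badset w x == b)].
  have hA : (#|A| <= \sum_(kappa : {ffun 'I_t -> 'I_3}) \sum_(b in small) #|cls kappa b|)%N.
    rewrite -sum1_card (partition_big (sample w) predT) //=.
    apply: leq_sum => kappa _.
    rewrite (partition_big (badset w) (mem small)) /=; last first.
      move=> x /andP[]; rewrite in_set => /andP[_ xb] _; rewrite in_set.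
      by apply: kN'; exact: le_trans hE.
    apply: leq_sum => b _; rewrite sum1_card; apply/subset_leq_card/subsetP => x.
    rewrite unfold_in => /andP[/andP[+ h1] h2]; rewrite in_set => /andP[xb _].
    by rewrite in_set xb h1 h2.
  move: hA; rewrite -(ler_nat R) => /le_trans; apply; rewrite natr_sum.
  have -> : 3 ^+ t = #|{: {ffun 'I_t -> 'I_3}}|%:R :> R by rewrite card_ffun !card_ord natrX.
  rewrite -sum_cst_in; apply: ler_sum => kappa _; rewrite natr_sum.
  apply: le_trans (_ : \sum_(b in small) expR beta <= _).
    apply: ler_sum => b; rewrite inE => bk; rewrite bE NE; apply: ln_card_sample_class => //.
    rewrite -ler_pdivlMr ?exprn_gt0 // -NE; apply: le_trans kN.
    by rewrite ler_nat.
  rewrite sum_cst_in ler_wpM2r ?expR_ge0 // NE -natrX natr1 -natrX ler_nat.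
  by rewrite -card_vertex card_small_sets.
apply: le_trans hB _.
have NX : (N + 1) ^+ k <= expR (k%:R * ((d%:R + 1) * ln 2)).
  rewrite expRM_natl lerXn2r ?nnegrE ?expR_ge0 ?addr_ge0 ?(ltW N0) //.
  rewrite natr1 expRM_natl lnK ?posrE // exprS -NE.
  have : 1 <= N by rewrite NE; apply: exprn_ege1; lra.
  lra.
have E3 : 3 ^+ t = expR (t%:R * ln 3) :> R by rewrite expRM_natl lnK ?posrE.
have E2 : 2 = expR (ln 2) :> R by rewrite lnK ?posrE.
apply: le_trans (_ : expR (ln 2) * (expR (t%:R * ln 3) *
  (expR (k%:R * ((d%:R + 1) * ln 2)) * expR beta)) <= _).
  rewrite -E2 -E3; apply: ler_wpM2l => //; apply: ler_wpM2l; first exact: exprn_ge0.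
  by apply: ler_wpM2r => //; exact: expR_ge0.
rewrite -!expRD ler_expR bE sE -NE dE.
apply: sampling_arith D11 _ => //.
- rewrite -dE NE -natrX ler_nat; exact/ltnW/ltn_expl.
- by rewrite ln2_ge ln2_le.
- by rewrite ln3_le ln_ge0 //; lra.
- by rewrite ler0n -dE.
- by rewrite ler0n -dE.
Qed.

(** * Mixing time *)

Section Bottleneck.
Variables (R : realType) (T : finType) (P : T -> T -> R).
Hypothesis P_kernel : transition_kernel P.
Hypothesis P_stat : stationary_dist P (uniform_dist R T).
Hypothesis T_gt0 : (0 < #|T|)%N.

Lemma kpow_ge0 t x y : 0 <= kpow P t x y.
Proof.
elim: t x y => [|t IH] x y /=; first exact: ler0n.
by apply: sumr_ge0 => z _; apply: mulr_ge0 => //; case: P_kernel => + _; apply.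
Qed.

Lemma kpow_sum1 t x : \sum_y kpow P t x y = 1.
Proof.
elim: t x => [|t IH] x /=.
  by rewrite (bigD1 x) //= eqxx big1 ?addr0 // => y; rewrite eq_sym => /negPf->.
rewrite exchange_big /= -[RHS](P_kernel.2 x); apply: eq_bigr => z _.
by rewrite -mulr_sumr IH mulr1.
Qed.

Lemma kpow_sum_le1 t x (Q : pred T) : \sum_(y | Q y) kpow P t x y <= 1.
Proof.
rewrite -(kpow_sum1 t x) [leRHS](bigID Q) /= lerDl.
by apply: sumr_ge0 => y _; exact: kpow_ge0.
Qed.

Lemma col_sum1 y : \sum_x P x y = 1.
Proof.
have T0 : #|T|%:R != 0 :> R by rewrite pnatr_eq0 -lt0n.
have := P_stat y; rewrite /uniform_dist -mulr_sumr => h.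
by apply: (mulfI (invr_neq0 T0)); rewrite h mulr1.
Qed.

(** The signed errors sum to 0, so the error on [F] is at most half of their absolute sum. *)
Lemma dTV_ge t x (F : {set T}) :
  \sum_(y in F) kpow P t x y - #|F|%:R / #|T|%:R <= dTV (kpow P t) (uniform_dist R T).
Proof.
have T0 : #|T|%:R != 0 :> R by rewrite pnatr_eq0 -lt0n.
apply: le_trans (le_bigmax _ (fun x => 2^-1 * \sum_y `|kpow P t x y - uniform_dist R T y|) x).
pose e y : R := kpow P t x y - uniform_dist R T y.
have eF : \sum_(y in F) e y = \sum_(y in F) kpow P t x y - #|F|%:R / #|T|%:R.
  by rewrite sumrB sum_cst_in.
have eT : \sum_(y in F) e y + \sum_(y | y \notin F) e y = 0.
  have <- : \sum_y e y = \sum_(y in F) e y + \sum_(y | y \notin F) e y by rewrite (bigID (mem F)).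
  by rewrite sumrB kpow_sum1 sum_cst_in divff // subrr.
have h1 : \sum_(y in F) e y <= \sum_(y in F) `|e y| by apply: ler_sum => y _; exact: ler_norm.
have h2 : - \sum_(y | y \notin F) e y <= \sum_(y | y \notin F) `|e y|.
  by rewrite -sumrN; apply: ler_sum => y _; rewrite -normrN ler_norm.
rewrite -eF.
have -> : \sum_y `|kpow P t x y - uniform_dist R T y| =
    \sum_(y in F) `|e y| + \sum_(y | y \notin F) `|e y| by rewrite (bigID (mem F)).
lra.
Qed.

(* By stationarity the mass that enters [B] in one step is at most [#|B|]. *)
Lemma leak_le (A B C : {set T}) t : A :|: B :|: C = setT -> [disjoint A & C] ->
  (forall x y, x \in A -> y \in C -> P x y = 0) ->
  \sum_(x in A) \sum_(y in C) kpow P t x y <= t%:R * #|B|%:R.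
Proof.
move=> ABC dAC noAC; elim: t => [|t IH].
  rewrite mul0r big1 // => x xA; rewrite big1 // => y yC /=.
  by case: eqP => // xy; have := disjointFr dAC xA; rewrite xy yC.
have -> : \sum_(x in A) \sum_(y in C) kpow P t.+1 x y =
  \sum_(x in A) \sum_z P x z * \sum_(y in C) kpow P t z y.
  by apply: eq_bigr => x _; rewrite /= exchange_big; apply: eq_bigr => z _; rewrite mulr_sumr.
have P0 x z : 0 <= P x z by case: P_kernel => + _; apply.
have k0 z : 0 <= \sum_(y in C) kpow P t z y by apply: sumr_ge0 => y _; exact: kpow_ge0.
rewrite exchange_big /= -natr1 mulrDl mul1r.
apply: le_trans (_ : \sum_z ((z \in A)%:R * \sum_(y in C) kpow P t z y + (z \in B)%:R) <= _).
  (* The first step leads to some [z]. In [A] the induction continues, because column sums are 1; in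
     [B] the contribution is at most 1; outside both, [z] is in [C], which cannot be reached from
     [A] in one step. *)
  apply: ler_sum => z _; rewrite -mulr_suml.
  have [s0 s1] : 0 <= \sum_(x in A) P x z /\ \sum_(x in A) P x z <= 1.
    split; first exact: sumr_ge0.
    by rewrite -(col_sum1 z) [leRHS](bigID (mem A)) /= lerDl sumr_ge0.
  have k1 := kpow_sum_le1 t z (mem C).
  case: (boolP (z \in A)) => zA /=.
    rewrite mul1r; apply: ler_wpDr; first exact: ler0n.
    by rewrite ler_piMl.
  rewrite mul0r add0r; case: (boolP (z \in B)) => zB /=; first exact: mulr_ile1.
  rewrite big1 ?mul0r // => x xA; apply: noAC => //.
  have : z \in A :|: B :|: C by rewrite ABC inE.
  by rewrite !inE (negPf zA) (negPf zB).
rewrite big_split /=; apply: lerD.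
  apply: le_trans IH; rewrite [leRHS]big_mkcond; apply: ler_sum => z _.
  by case: (z \in A); rewrite ?mul1r ?mul0r.
rewrite -[in leRHS]sum1_card natr_sum [leRHS]big_mkcond; apply: ler_sum => z _.
by case: (z \in B).
Qed.

(** Near stationarity, every start in [A] must have sent mass at least [#|C| / #|T| - q] to [C];
    summing over [A] contradicts [leak_le] unless [t] is large. *)
Lemma dTV_bottleneck (A B C : {set T}) t (q : R) : A :|: B :|: C = setT -> [disjoint A & C] ->
  (forall x y, x \in A -> y \in C -> P x y = 0) ->
  dTV (kpow P t) (uniform_dist R T) <= q ->
  #|A|%:R * (#|C|%:R / #|T|%:R - q) <= t%:R * #|B|%:R.
Proof.
move=> ABC dAC noAC hq; apply: le_trans (leak_le t ABC dAC noAC).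
rewrite -sum_cst_in; apply: ler_sum => x _.
have := le_trans (dTV_ge t x (~: C)) hq.
have T0 : #|T|%:R != 0 :> R by rewrite pnatr_eq0 -lt0n.
have -> : #|~: C|%:R / #|T|%:R = 1 - #|C|%:R / #|T|%:R :> R.
  by rewrite cardsCs setCK natrB ?max_card // mulrBl divff.
have -> : \sum_(y in ~: C) kpow P t x y = \sum_(y | y \notin C) kpow P t x y.
  by apply: eq_bigl => y; rewrite inE.
have := kpow_sum1 t x; rewrite (bigID (mem C)) /=; lra.
Qed.

End Bottleneck.

Lemma mixing_time_ge (R : realType) (T : finType) (P : T -> T -> R) (pi : T -> R) (a : R) :
  (forall t, dTV (kpow P t) pi <= (expR 1)^-1 -> a <= t%:R) ->
  (a%:E <= mixing_time P pi)%E.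
Proof.
move=> H; rewrite /mixing_time; case: pselect => [ex|_]; last exact: leey.
by rewrite lee_fin; case: ex_minnP => m /H.
Qed.

Lemma expR1_inv_le (R : realType) : (expR 1)^-1 <= 4 / 9 :> R.
Proof.
rewrite -[leLHS]mul1r ler_pdivrMr ?expR_gt0 //.
have -> : expR 1 = expR (1 / 2) * expR (1 / 2) :> R by rewrite -expRD; congr expR; lra.
have := expR_ge1Dx (1 / 2 : R) => h.
have h1 : 3 / 2 <= expR (1 / 2) :> R by lra.
have h2 : 0 <= 3 / 2 :> R by lra.
have := ler_pM h2 h2 h1 h1; lra.
Qed.

(** For [rho < 1], [ln x <= x - 1] at [rho] and [1 - rho] gives
    [2 * rho * (1 - rho) < (1 - rho) * ln 2], and [ln 2 <= 3 / 4]. *)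
Lemma entropy_le_three_eighths (R : realType) (rho : R) : 0 < rho -> rho <= 1 ->
  entropy rho + rho < 1 -> rho <= 3 / 8.
Proof.
move=> r0 r1; rewrite /entropy /log2 => h.
have L0 := ln2_gt0 R; have L2 := ln2_le R.
have {}h : - rho * ln rho - (1 - rho) * ln (1 - rho) < (1 - rho) * ln 2.
  have Lu : ln 2 != 0 :> R by rewrite lt0r_neq0.
  rewrite -(divfK Lu (ln rho)) -(divfK Lu (ln (1 - rho))).
  move: h; rewrite -(ltr_pM2r L0); lra.
have h1 := ler_wpM2l (ltW r0) (ln_le_subr1 r0).
have [re|rn] := eqVneq rho 1.
  by move: h; rewrite re subrr ln1; lra.
have r1' : 0 < 1 - rho by rewrite subr_gt0 lt_neqAle rn.
have h2 := ler_wpM2l (ltW r1') (ln_le_subr1 r1').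
rewrite -(ler_pM2l r1'); have := ler_wpM2l (ltW r1') L2; lra.
Qed.

(** * Counting colourings and their symmetries *)

Section Colorings.
Variables (R : realType) (d : nat).
Hypothesis d_gt0 : (0 < d)%N.
Implicit Types (c : coloring3 d) (b : bool).

Lemma proper_coloringP (x : {ffun vertex d -> 'I_3}) :
  (forall v i, x (flip i v) != x v) -> proper_coloring x.
Proof.
move=> H; apply/forallP => u; apply/forallP => v; apply/implyP => /adjacentP [i ->].
by rewrite eq_sym.
Qed.

Definition mk_coloring x (px : proper_coloring x) : coloring3 d := exist _ x px.

Lemma map_coloring_proper c (f : vertex d -> vertex d) (g : 'I_3 -> 'I_3) :
  (forall v i, exists j, f (flip i v) = flip j (f v)) -> injective g ->
  proper_coloring [ffun v => g (val c (f v))].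
Proof.
move=> hf gI; apply: proper_coloringP => v i; rewrite !ffunE (inj_eq gI).
by have [j ->] := hf v i; exact: proper_flip (valP c).
Qed.

(** All even vertices receive colour 0 and the odd ones choose freely between 1 and 2. *)
Lemma card_coloring3_ge : expR (2 ^+ d / 2 * ln 2) <= #|{: coloring3 d}|%:R :> R.
Proof.
rewrite -(card_parityR R d_gt0 true) expRM_natl lnK ?posrE // -natrX ler_nat.
set O := [pred v : vertex d | parity v == true].
pose col (Q : {set vertex d}) : {ffun vertex d -> 'I_3} :=
  [ffun v => if parity v then (if v \in Q then @Ordinal 3 1 isT else @Ordinal 3 2 isT) else ord0].
have colp Q : proper_coloring (col Q).
  apply: proper_coloringP => v i; rewrite !ffunE parity_flip.
  by case: (parity v) => /=; case: ifP.
pose f (Q : {set vertex d}) : coloring3 d := mk_coloring (colp Q).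
have fI : {in powerset [set v | parity v] &, injective f}.
  move=> Q Q'; rewrite !inE => /subsetP hQ /subsetP hQ' [/ffunP h].
  apply/setP => v; have := h v; rewrite !ffunE.
  case: (boolP (parity v)) => pv.
    by case: (v \in Q); case: (v \in Q') => // /(congr1 val).
  move=> _; transitivity false.
    by apply/negP => /hQ; rewrite inE (negPf pv).
  by apply/esym/negP => /hQ'; rewrite inE (negPf pv).
have -> : #|O| = #|[set v : vertex d | parity v]|.
  by apply: eq_card => v; rewrite !inE eqb_id.
by rewrite -card_powerset -(card_in_imset fI) max_card.
Qed.

Lemma card_coloring3_gt0 : (0 < #|{: coloring3 d}|)%N.
Proof. by rewrite -(ltr0n R) (lt_le_trans (expR_gt0 _) card_coloring3_ge). Qed.

(* The ball is disjoint from its image under a cyclic shift of the colours. *)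
Lemma card_ball_le c (r : R) : 2 * r < 2 ^+ d ->
  2 * #|[set c' | (hamming c c')%:R <= r]|%:R <= #|{: coloring3 d}|%:R :> R.
Proof.
move=> hr; set F := [set c' | _].
have gI : injective (fun a : 'I_3 => a + 1) by exact: addIr.
pose sh c' : coloring3 d := mk_coloring
    (@map_coloring_proper c' id _ (fun v i => ex_intro _ i erefl) gI).
have shE c' v : val (sh c') v = val c' v + 1 by rewrite ffunE.
have shI : injective sh.
  move=> c1 c2 h; apply/val_inj/ffunP => v; have := shE c1 v; rewrite h shE.
  by move=> /gI.
have dis : [disjoint F & sh @: F].
  rewrite -setI_eq0; apply/eqP/setP => c'; rewrite in_set in_set0; apply/negP.
  move=> /andP[c1F /imsetP [c2 c2F] c1E]; move: c1F c2F; rewrite !in_set => h1 h2.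
  suff : (2 ^ d <= hamming c c' + hamming c c2)%N.
    rewrite -(ler_nat R) natrX natrD; lra.
  rewrite -card_vertex -sum1_card /hamming -!sum1_card.
  rewrite [X in (_ <= X + _)%N]big_mkcond [X in (_ <= _ + X)%N]big_mkcond -big_split /=.
  apply: leq_sum => v _; rewrite !inE c1E shE.
  case: (eqVneq (val c v) (val c2 v)) => [->|]; last by rewrite addn1.
  suff -> : val c2 v != val c2 v + 1 by [].
  by rewrite eq_sym -subr_eq0 addrAC subrr add0r oner_neq0.
rewrite mulrC mulr_natr mulr2n -natrD -[X in (_ + X)%:R](card_imset _ shI) ler_nat.
move: dis; rewrite -leq_card_setU => /eqP <-; exact: max_card.
Qed.

Definition tilted b : {set coloring3 d} :=
  [set c | #|zeros (~~ b) (val c)|%:R + 3 / 16 * 2 ^+ d < #|zeros b (val c)|%:R :> R].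

Definition untilted : {set coloring3 d} := [set c | balanced R (val c)].

Lemma card_untilted : #|untilted| = #|balanced_colorings R d|.
Proof.
rewrite -(card_imset untilted val_inj); apply: eq_card => x; rewrite [RHS]in_set.
apply/imsetP/andP => [[c]|[px bx]].
  by rewrite in_set => bc ->; split; first exact: valP.
by exists (mk_coloring px); rewrite ?in_set.
Qed.

Lemma tilted_cover : tilted true :|: untilted :|: tilted false = setT.
Proof.
apply/setP => c; rewrite !in_setU !in_set /balanced.
case: (ltrP (#|zeros (~~ true) (val c)|%:R + 3 / 16 * 2 ^+ d) (#|zeros true (val c)|%:R : R)) => //= h1.
rewrite orbC; case: ltrP => //= h2.
by apply/forallP => -[].
Qed.

Lemma tilted_disjoint : [disjoint tilted true & tilted false].
Proof.
rewrite -setI_eq0; apply/eqP/setP => c; rewrite in_setI in_set0; apply/negP.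
rewrite !in_set /= => /andP[h1 h2].
have : 0 < 2 ^+ d :> R by rewrite exprn_gt0.
move: h1 h2; lra.
Qed.

(** Precomposition with one coordinate flip exchanges the two parity classes. *)
Lemma card_tilted : #|tilted true| = #|tilted false|.
Proof.
pose i0 : 'I_d := Ordinal d_gt0.
pose sw c : coloring3 d := mk_coloring
  (@map_coloring_proper c (flip i0) id (fun v i => ex_intro _ i (flipC i0 i v)) (@inj_id _)).
have swE c v : val (sw c) v = val c (flip i0 v) by rewrite ffunE.
have swK : involutive sw.
  by move=> c; apply/val_inj/ffunP => v; rewrite !swE flipK.
have sz b c : #|zeros b (val (sw c))| = #|zeros (~~ b) (val c)|.
  rewrite -(card_imset _ (@flip_inj d i0)); apply: eq_card => v.
  apply/imsetP/idP => [[u]|].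
    by rewrite !in_set swE => /andP[/eqP <- uz] ->; rewrite parity_flip eqxx.
  rewrite in_set => /andP[/eqP pv vz]; exists (flip i0 v); rewrite ?flipK //.
  by rewrite in_set swE flipK vz parity_flip pv negbK eqxx.
rewrite -(card_imset _ (inv_inj swK)); apply: eq_card => c.
apply/imsetP/idP => [[c']|].
  by rewrite !in_set => h ->; rewrite !sz.
by move=> h; exists (sw c); rewrite ?swK //; move: h; rewrite !in_set !sz.
Qed.

Lemma zeros_hamming b c c' :
  (#|zeros b (val c)| <= #|zeros b (val c')| + #|[pred v | (parity v == b) && (val c v != val c' v)]|)%N.
Proof.
rewrite -!sum1_card [X in (X <= _)%N]big_mkcond [X in (_ <= X + _)%N]big_mkcond.
rewrite [X in (_ <= _ + X)%N]big_mkcond -big_split /=; apply: leq_sum => v _.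
rewrite !in_set !inE; case: (parity v == b) => //=.
by case: (eqVneq (val c v) (val c' v)) => [->|]; do ?case: (_ == _).
Qed.

(** Recolouring one vertex changes the difference of the two counts by at most 1, and the difference
    must pass from above [3 / 16 * 2 ^+ d] to below its opposite. The threshold 3/16 is half of the
    bound 3/8 on [rho]. *)
Lemma tilted_separated c c' : c \in tilted true -> c' \in tilted false ->
  3 / 8 * 2 ^+ d < (hamming c c')%:R :> R.
Proof.
rewrite !in_set /= => h1 h2.
have h3 := zeros_hamming true c c'; have := zeros_hamming false c' c => h4.
have : (#|[pred v | (parity v == true) && (val c v != val c' v)]| +
   #|[pred v | (parity v == false) && (val c' v != val c v)]| = hamming c c')%N.
  rewrite /hamming -[RHS](cardID [pred v | parity v == true]) //.
  congr addn; apply: eq_card => v; rewrite !inE; first by rewrite andbC.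
  by rewrite [in RHS](eq_sym (val c v)); case: (parity v).
move: h3 h4; rewrite -!(ler_nat R) !natrD => h3 h4 /(congr1 (fun n => n%:R : R)).
rewrite natrD; lra.
Qed.

End Colorings.

(** * Lower bounds on the time to mix *)

Section MixingBounds.
Variables (R : realType) (d : nat) (rho : R) (P : coloring3 d -> coloring3 d -> R).
Hypothesis d_gt0 : (0 < d)%N.
Hypothesis rho_ge0 : 0 <= rho.
Hypothesis rho_le : rho <= 3 / 8.
Hypothesis P_kernel : transition_kernel P.
Hypothesis P_local : local_chain rho P.
Hypothesis P_stat : stationary_dist P (uniform_dist R (coloring3 d)).

Let N_gt0 : 0 < 2 ^+ d :> R. Proof. by rewrite exprn_gt0. Qed.
Let T_gt0 : (0 < #|{: coloring3 d}|)%N. Proof. exact: (card_coloring3_gt0 R d_gt0). Qed.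
Let TR_gt0 : 0 < #|{: coloring3 d}|%:R :> R. Proof. by rewrite ltr0n. Qed.

(** For small [d]: after at most one step the chain is still in a Hamming ball holding at most half
    of the colourings, so the distance is at least 1/2. *)
Lemma mixing_ge2 t : dTV (kpow P t) (uniform_dist R (coloring3 d)) <= 4 / 9 -> (2 <= t)%N.
Proof.
move=> ht; have [c _] := card_gt0P T_gt0.
pose F := [set c' : coloring3 d | (hamming c c')%:R <= rho * #|{: vertex d}|%:R].
have hF : 2 * #|F|%:R <= #|{: coloring3 d}|%:R :> R.
  apply: card_ball_le; rewrite card_vertex natrX.
  have := ler_wpM2r (ltW N_gt0) rho_le; have := N_gt0; lra.
rewrite ltnNge; apply/negP => t1.
have mass1 : \sum_(y in F) kpow P t c y = 1.
  case: t t1 {ht} => [|[|//]] _.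
    rewrite (bigD1 c) /=; last first.
      rewrite inE (_ : hamming c c = 0)%N ?mulr_ge0 //.
      by apply: eq_card0 => v; rewrite !inE eqxx.
    by rewrite eqxx big1 ?addr0 // => y /andP[_]; rewrite eq_sym => /negPf->.
  rewrite /= exchange_big /= -[RHS](P_kernel.2 c); apply: eq_bigr => z _.
  rewrite -mulr_sumr; case: (boolP (z \in F)) => zF.
    rewrite (bigD1 z) //= eqxx big1 ?addr0 ?mulr1 // => y /andP[_].
    by rewrite eq_sym => /negPf->.
  suff -> : P c z = 0 by rewrite mul0r.
  by apply/eqP; apply: contraNT zF => /P_local; rewrite inE.
have := le_trans (dTV_ge P_kernel T_gt0 t c F) ht.
rewrite mass1 => h; have : #|F|%:R / #|{: coloring3 d}|%:R <= 1 / 2 :> R.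
  by rewrite ler_pdivrMr //; lra.
lra.
Qed.

Lemma mixing_ge_exp (y : R) t : 200 <= y ->
  #|untilted R d|%:R <= expR (2 ^+ d / 2 * ln 2 - y) ->
  dTV (kpow P t) (uniform_dist R (coloring3 d)) <= 4 / 9 -> expR (y / 2) <= t%:R.
Proof.
move=> hy hB ht.
have sep c c' : c \in tilted R d true -> c' \in tilted R d false -> P c c' = 0.
  move=> cA cC; apply/eqP; apply/negPn/negP => /P_local; apply/negP; rewrite -ltNge.
  apply: le_lt_trans (tilted_separated cA cC); rewrite card_vertex natrX.
  by rewrite ler_wpM2r // ltW.
have := dTV_bottleneck P_kernel P_stat T_gt0 (tilted_cover R d) (tilted_disjoint R d) sep ht.
rewrite -(card_tilted R d_gt0).
have hT : #|{: coloring3 d}|%:R <=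
      #|tilted R d true|%:R + #|tilted R d true|%:R + #|untilted R d|%:R :> R.
  rewrite -!natrD ler_nat -cardsT -(tilted_cover R d).
  apply: leq_trans (leq_card_setU _ _).1 _; rewrite -(card_tilted R d_gt0) addnAC leq_add2r.
  exact: (leq_card_setU _ _).1.
have {}hB : #|untilted R d|%:R * expR y <= #|{: coloring3 d}|%:R.
  apply: le_trans (card_coloring3_ge R d_gt0).
  by rewrite -(ler_pM2r (expR_gt0 (- y))) -[leLHS]mulrA expRxMexpNx_1 mulr1 -expRD.
move: hT hB; set a : R := #|tilted R d true|%:R; set b : R := #|untilted R d|%:R.
set T : R := #|_|%:R => hT hB hm.
have b0 : 0 <= b by [].
have t0 : 0 <= t%:R :> R by [].
have y2 : 100 <= expR (y / 2) by apply: le_trans (expR_ge1Dx _); lra.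
have ey : 100 * expR (y / 2) <= expR y.
  have -> : expR y = expR (y / 2) * expR (y / 2) by rewrite -expRD; congr expR; lra.
  by rewrite ler_wpM2r // expR_ge0.
have bT : 100 * b <= T.
  apply: le_trans hB; rewrite mulrC; apply: ler_wpM2l => //.
  apply: le_trans ey; have := expR_ge0 (y / 2); lra.
(* The two tilted sides have equal size and the balanced part takes at most 1/100 of the whole;
   48/100 exceeds 4/9 by enough for the bottleneck bound. *)
have aT : 48 / 100 * T <= a by lra.
have aTd : 48 / 100 <= a / T by rewrite ler_pdivlMr.
have h1 : T / 100 <= t%:R * b.
  apply: le_trans hm; apply: le_trans (_ : 48 / 100 * T * (48 / 100 - 4 / 9) <= _).
    have : 0 < T by []; lra.
  apply: ler_pM => //; [by rewrite mulr_ge0 ?ltW //; lra | lra | lra].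
have h2 : t%:R * (b * expR y) <= t%:R * T by apply: ler_wpM2l.
have h3 : T / 100 * expR y <= t%:R * T.
  by apply: le_trans h2; rewrite mulrA ler_wpM2r // expR_ge0.
have : expR y / 100 <= t%:R by rewrite -(ler_pM2r TR_gt0); lra.
lra.
Qed.

End MixingBounds.

Theorem corollary1p4 (R : realType) (rho : R) (rho_gt0 : 0 < rho)
    (rho_le1 : rho <= 1) (Hrho : entropy rho + rho < 1) :
  exists C : R, 0 < C /\
    forall (d : nat) (P : coloring3 d -> coloring3 d -> R),
      (2 <= d)%N ->
      transition_kernel P ->
      ergodic_chain P ->
      local_chain rho P ->
      stationary_dist P (uniform_dist R (coloring3 d)) ->
      ((2 `^ (C * 2 ^+ d / (Num.sqrt d%:R * log2 d%:R)))%:E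
        <= mixing_time P (uniform_dist R (coloring3 d)))%E.
Proof.
have rho38 := entropy_le_three_eighths rho_gt0 rho_le1 Hrho.
(* Beyond [D] the fourth root of [d] reaches [10 ^+ 13 = 10 ^+ 4 * 10 ^+ 9], as
   [card_balanced_colorings] demands. *)
have [D hD] : exists D : nat, forall d, (D <= d)%N ->
    10 ^+ 13 <= Num.sqrt (Num.sqrt d%:R) :> R.
  exists (Num.bound (((10 ^+ 13) ^+ 2) ^+ 2 : R)) => d hd.
  have p0 : 0 <= (10 ^+ 13) ^+ 2 :> R by apply: exprn_ge0; apply: exprn_ge0; lra.
  have : ((10 ^+ 13) ^+ 2) ^+ 2 <= d%:R :> R.
    by apply: le_trans (ltW (archi_boundP (exprn_ge0 2 p0))) _; rewrite ler_nat.
  move=> /ler_wsqrtr; rewrite sqrtr_sqr ger0_norm // => /ler_wsqrtr.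
  by rewrite sqrtr_sqr ger0_norm //; apply: exprn_ge0; lra.
have [Q QE] : exists Q : R, Q = 10 ^+ 9 by exists (10 ^+ 9).
have Q1 : 1 <= Q by rewrite QE; apply: exprn_ege1; lra.
(* The factor [(2 ^+ D)^-1] keeps the exponent at most 1 when [d < D], so that a bound of 2 suffices
   there; [4 * Q] makes the exponent at most [y / 2] for larger [d]. *)
pose C : R := (2 ^+ D)^-1 / (4 * Q).
have D1 : 1 <= 2 ^+ D :> R by apply: exprn_ege1; lra.
have C0 : 0 < C by rewrite /C divr_gt0 ?invr_gt0; lra.
have CQ : C <= (4 * Q)^-1.
  rewrite /C -[leRHS]mul1r ler_wpM2r ?invr_ge0 //; first lra.
  by rewrite invf_le1 //; lra.
exists C; split=> // d P d2 kerP _ locP statP.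
have d_gt0 : (0 < d)%N by exact: ltnW.
have N0 : 0 < 2 ^+ d :> R by rewrite exprn_gt0.
have L0 := ln2_gt0 R; have L2 := ln2_le R.
have s1 : 1 <= Num.sqrt d%:R :> R by rewrite -[leLHS]sqrtr1 ler_wsqrtr // ler1n.
have lg1 : 1 <= log2 d%:R :> R.
  by rewrite /log2 ler_pdivlMr // mul1r ler_ln ?posrE ?ltr0n // ler_nat.
have s0 : 0 < Num.sqrt d%:R :> R by lra.
set Y := C * 2 ^+ d / _.
have hY : Y <= C * (2 ^+ d / Num.sqrt d%:R).
  rewrite /Y -mulrA; apply: ler_wpM2l; first exact: ltW.
  apply: ler_wpM2l; first exact: ltW.
  have slg : 0 < Num.sqrt d%:R * log2 d%:R :> R by apply: mulr_gt0 => //; lra.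
  by rewrite lef_pV2 ?posrE // ler_peMr // ltW.
apply: mixing_time_ge => t /le_trans /(_ (expR1_inv_le R)) ht.
case: (leqP D d) => [/hD hd|dD]; last first.
  have t2 := mixing_ge2 d_gt0 (ltW rho_gt0) rho38 kerP locP ht.
  apply: le_trans (_ : 2 <= _); last by rewrite ler_nat.
  rewrite -[leRHS]powRr1 //; apply: ler_powR; first lra.
  apply: le_trans hY _; rewrite mulrA ler_pdivrMr // mul1r; apply: le_trans s1.
  rewrite /C mulrAC ler_pdivrMr; last lra.
  apply: le_trans (_ : 1 <= _); last lra.
  by rewrite mulrC ler_pdivrMr ?mul1r ?exprn_gt0 // ler_weXn2l ?ler1n // ltnW.
set s : R := Num.sqrt d%:R in hY s1 s0 hd *.
have := card_balanced_colorings hd; rewrite -card_untilted -/s -QE => hB.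
set y := _ / (2 * Q) in hB.
have hy : 200 <= y.
  have sq : s ^+ 2 = d%:R by rewrite sqr_sqrtr.
  have z2 : Num.sqrt s ^+ 2 = s by rewrite sqr_sqrtr // ltW.
  have sN : s <= 2 ^+ d / s.
    rewrite ler_pdivlMr // -expr2 sq -natrX ler_nat; exact/ltnW/ltn_expl.
  have hs : 10 ^+ 13 <= s.
    apply: le_trans hd _; rewrite -{2}z2 expr2 ler_peMl ?sqrtr_ge0 //.
    by rewrite -[leLHS]sqrtr1 ler_wsqrtr.
  rewrite /y ler_pdivlMr; last lra.
  apply: le_trans sN; apply: le_trans hs; rewrite QE; lra.
apply: le_trans (mixing_ge_exp d_gt0 rho38 kerP locP statP hy hB ht).
rewrite /powR gt_eqF // ler_expR.
have Y2 : Y <= y / 2.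
  apply: le_trans hY _; apply: le_trans (ler_wpM2r (divr_ge0 (ltW N0) (ltW s0)) CQ) _.
  rewrite le_eqVlt; apply/orP; left; apply/eqP; rewrite /y; field.
  by rewrite !lt0r_neq0 //; lra.
(* The base changes from 2 to e at no cost, since [ln 2 <= 1] and [Y] is nonnegative. *)
apply: le_trans (_ : Y * 1 <= _); last lra.
apply: ler_wpM2l; last lra.
apply: divr_ge0; apply: mulr_ge0; [exact: ltW|exact: ltW|exact: ltW|].
exact: le_trans ler01 lg1.
Qed.
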